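(* Let $s\ge 6$ be even, $N\ge 2s$, and let $x,y\in SO(3)$ with $\omega(y^{-1}x)\ge \frac{\pi}{2(N+1)}$. Then for all $i,n\in\{1,2,3\}$, $$|X_n^y\sigma_N(x,y)|\le \frac{c_{1,s}}{(N+1)^{s-1}\omega(y^{-1}x)^s},\qquad |X_i^xX_n^y\sigma_N(x,y)|\le \frac{c_{2,s}}{(N+1)^{s-2}\omega(y^{-1}x)^s}.$$
   Context: $SO(3)=\{x\in\mathbb R^{3\times 3}: x^Tx=I,\ \det x=1\}$; $\omega(x)=\arccos((\operatorname{tr}x-1)/2)\in[0,\pi]$ is the rotation angle. Let $\mathcal L_1,\mathcal L_2,\mathcal L_3$ be the generators of $\mathfrak{so}(3)$ with $e^{t\mathcal L_1},e^{t\mathcal L_2},e^{t\mathcal L_3}$ the rotations by angle $t$ about the first, second, third coordinate axis (e.g. $\mathcal L_3=\begin{pmatrix}0&-1&0\\1&0&0\\0&0&0\end{pmatrix}$, and cyclically). For differentiable $f$ on $SO(3)$, $X_if(x)=\frac{d}{dt}f(xe^{t\mathcal L_i})\big|_{t=0}$; for functions of two variables $X_i^x$, $X_i^y$ act on the first resp. second variable. Kernel: for even $s\ge 6$ let $g_{s-1}(x)=\frac{(-1)^{s-1}}{(s-2)!}\int_{-1}^{x}\sum_{k=0}^{s-1}(-1)^k\chi_{(\cos(\frac{(k+1)\pi}{s}),\cos(\frac{k\pi}{s})]}(t)(x-t)^{s-2}\,dt$ for $x\in[-1,1]$ and $g_{s-1}(x)=0$ otherwise (the perfect B-spline, supported in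 $[-1,1]$), and $\tilde g_{s-1}(x)=g_{s-1}(2x)$. For $N\in\mathbb N$ put $\|\tilde g_{s-1}\|_{1,N}=\sum_{k=-N}^N\tilde g_{s-1}(\frac{k}{2(N+1)})$, $\tilde\sigma_N(t)=\|\tilde g_{s-1}\|_{1,N}^{-1}\sum_{k=-N}^{N}\tilde g_{s-1}(\frac{k}{2(N+1)})e^{ikt}$, and $\sigma_N(x,y)=\tilde\sigma_N(\omega(y^{-1}x))$ for $x,y\in SO(3)$ (this is a finite linear combination of products $D^l_{k,m}(x)\overline{D^l_{k,m}(y)}$, $l\le N$, of Wigner D-functions, hence smooth). Constants: $c_{1,s}=1.02\,(s-1)!\,2^s\cdot 2s$, $c_{2,s}=1.02\,(s-1)!\,2^s(4s+1)$. *)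

(* Defs.v *)
From Stdlib Require Import Reals Lra Lia ZArith Classical ClassicalEpsilon.
Open Scope R_scope.

(* 3x3 real matrices, entries indexed by 0,1,2 (other indices are ignored). *)
Definition Mat := nat -> nat -> R.

Definition mmul (a b : Mat) : Mat :=
  fun i j => a i 0%nat * b 0%nat j + a i 1%nat * b 1%nat j + a i 2%nat * b 2%nat j.

Definition mtr (a : Mat) : Mat := fun i j => a j i.

Definition trace (a : Mat) : R := a 0%nat 0%nat + a 1%nat 1%nat + a 2%nat 2%nat.

Definition det3 (a : Mat) : R :=
    a 0%nat 0%nat * (a 1%nat 1%nat * a 2%nat 2%nat - a 1%nat 2%nat * a 2%nat 1%nat)
  - a 0%nat 1%nat * (a 1%nat 0%nat * a 2%nat 2%nat - a 1%nat 2%nat * a 2%nat 0%nat)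
  + a 0%nat 2%nat * (a 1%nat 0%nat * a 2%nat 1%nat - a 1%nat 1%nat * a 2%nat 0%nat).

Definition kdelta (i j : nat) : R := if Nat.eq_dec i j then 1 else 0.

Definition inSO3 (x : Mat) : Prop :=
  (forall i j : nat, (i < 3)%nat -> (j < 3)%nat -> mmul (mtr x) x i j = kdelta i j)
  /\ det3 x = 1.

Definition omega (x : Mat) : R := acos ((trace x - 1) / 2).

(* exp(t L_i), i = 1,2,3: rotation by angle t about the i-th coordinate axis,
   L_1 = [[0,0,0],[0,0,-1],[0,1,0]], L_2 = [[0,0,1],[0,0,0],[-1,0,0]],
   L_3 = [[0,-1,0],[1,0,0],[0,0,0]]. Entries listed row by row. *)
Definition mat_of (a00 a01 a02 a10 a11 a12 a20 a21 a22 : R) : Mat :=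
  fun i j =>
    match i, j with
    | 0, 0 => a00 | 0, 1 => a01 | 0, 2 => a02
    | 1, 0 => a10 | 1, 1 => a11 | 1, 2 => a12
    | 2, 0 => a20 | 2, 1 => a21 | 2, 2 => a22
    | _, _ => 0%R
    end%nat.

Definition expL (i : nat) (t : R) : Mat :=
  match i with
  | 1%nat => mat_of 1 0 0  0 (cos t) (- sin t)  0 (sin t) (cos t)
  | 2%nat => mat_of (cos t) 0 (sin t)  0 1 0  (- sin t) 0 (cos t)
  | _ => mat_of (cos t) (- sin t) 0  (sin t) (cos t) 0  0 0 1
  end.

(* Riemann integral of f over [a,b] (0 if f is not Riemann integrable). *)
Definition RInt (f : R -> R) (a b : R) : R :=
  match excluded_middle_informative (exists v, exists pr : Riemann_integrable f a b,
                                              RiemannInt pr = v) with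
  | left H => proj1_sig (constructive_indefinite_description _ H)
  | right _ => 0
  end.

Definition chi (a b t : R) : R :=
  if Rlt_dec a t then (if Rle_dec t b then 1 else 0) else 0.

(* perfect B-spline g_{s-1}, supported in [-1,1] *)
Definition gspline (s : nat) (x : R) : R :=
  if Rle_dec (-1) x then
    if Rle_dec x 1 then
      (-1) ^ (s - 1) / INR (fact (s - 2)) *
      RInt (fun t => sum_f_R0 (fun k => (-1) ^ k *
                 chi (cos (INR (k + 1) * PI / INR s)) (cos (INR k * PI / INR s)) t *
                 (x - t) ^ (s - 2)) (s - 1)) (-1) x
    else 0
  else 0.

Definition gtilde (s : nat) (x : R) : R := gspline s (2 * x).

(* coefficient gtilde(k/(2(N+1))) for k = j - N, j = 0..2N *)
Definition coef (s N : nat) (j : nat) : R :=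
  gtilde s (IZR (Z.of_nat j - Z.of_nat N) / (2 * INR (N + 1))).

Definition kval (N j : nat) : R := IZR (Z.of_nat j - Z.of_nat N).

Definition gnorm (s N : nat) : R := sum_f_R0 (coef s N) (2 * N).

(* sigma~_N(t) = ||g||^{-1} sum_{k=-N}^N gtilde(k/(2(N+1))) e^{ikt}, real and
   imaginary parts *)
Definition sigt_re (s N : nat) (t : R) : R :=
  / gnorm s N * sum_f_R0 (fun j => coef s N j * cos (kval N j * t)) (2 * N).
Definition sigt_im (s N : nat) (t : R) : R :=
  / gnorm s N * sum_f_R0 (fun j => coef s N j * sin (kval N j * t)) (2 * N).

(* sigma_N(x,y) = sigma~_N(omega(y^{-1} x)); y^{-1} = y^T on SO(3) *)
Definition sigma_re (s N : nat) (x y : Mat) : R := sigt_re s N (omega (mmul (mtr y) x)).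
Definition sigma_im (s N : nat) (x y : Mat) : R := sigt_im s N (omega (mmul (mtr y) x)).

Definition cst1 (s : nat) : R := 102 / 100 * INR (fact (s - 1)) * 2 ^ s * (2 * INR s).
Definition cst2 (s : nat) : R := 102 / 100 * INR (fact (s - 1)) * 2 ^ s * (4 * INR s + 1).

Definition cmod (a b : R) : R := sqrt (a ^ 2 + b ^ 2).

(* Main.v *)
(** The coefficients are samples [g(k/(N+1))] of a spline whose derivative of order
    [s-1] is piecewise [1] or [-1] with [s+1] knots [cos (k pi / s)], so that the
    [s]-th differences of the samples of [g], [x g] and [x^2 g] with step [h] are
    summable with sum [O(h^(s-1))].  Summation by parts turns this into a bound by
    [|2 sin(t/2)|^(-s)] for the trigonometric sums.  That loses a factor [(pi/2)^s] near
    [t = pi]; to recover it, the sum is written as an average of the [2^n] sums with step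
    [h/2^n] at the frequencies [(t + 2 pi m)/2^n] (a finite Poisson summation), each term
    is bounded by parts, and [n] tends to infinity.  The identity
    [sum_m (2^n 2 sin((t+2 pi m)/2^(n+1)))^(-2) = (2 sin(t/2))^(-2)] controls the tail.
    The norming constant is compared with [integral g = 2^(2-s)/(s-1)!] by the same
    refinement.

    Since [g] is even, the kernel is a polynomial in [cos omega = (tr(y^T x) - 1)/2].
    Its derivatives along the rotations are computed from the entries of [y^T x], which
    avoids the singularity of [acos] at [omega = pi]. *)

From Coquelicot Require Import Coquelicot.
Require Import Defs.
From Stdlib Require Import Reals Lra Lia Arith Factorial ClassicalEpsilon ZArith.
Open Scope R_scope.


(** Both constants come from the variation bounds. Dividing h^(s-1) V by the norm, about (N+1) 4 /
    (2^s (s-1)!), leaves V/4 times the common factor, and x g has V = 4s. The remaining 2 in [cst1]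
    is aliasing: at t = pi the frequencies t and t - 2 pi are equally close to zero, so the main
    term counts twice, and 1.02 absorbs the other aliases and the error of the norm. The obstacle is
    x^2 g. Its expansion contains s(s+1) times the spline integrated twice more, while [cst2] is
    linear in s. The factor s is saved by cancellation between neighbouring knots: the piecewise
    affine spline at the bottom of the tower is bounded by tan(pi/(2s)). On the group, the mixed
    second derivative also contains the first derivative of the kernel, with a factor of size 1/t.
    This factor may be of order N when t is small, but there aliasing is negligible; so small and
    large t are estimated apart. The second case at s = 6 leaves less than one percent, hence the
    fine decimals. *)

(** * Finite sums and elementary trigonometric sums *)

Fixpoint rsum (f : nat -> R) (n : nat) : R :=
  match n with O => 0 | S m => rsum f m + f m end.

Lemma rsum_ext (f g : nat -> R) n :
  (forall k, (k < n)%nat -> f k = g k) -> rsum f n = rsum g n.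
Proof.
  induction n as [|n IH]; intros H; simpl; [reflexivity|].
  rewrite IH by (intros; apply H; lia). rewrite H by lia. reflexivity.
Qed.

Lemma rsum_plus (f g : nat -> R) n :
  rsum (fun k => f k + g k) n = rsum f n + rsum g n.
Proof. induction n as [|n IH]; simpl; [ring|rewrite IH; ring]. Qed.

Lemma rsum_scal (a : R) (f : nat -> R) n :
  rsum (fun k => a * f k) n = a * rsum f n.
Proof. induction n as [|n IH]; simpl; [ring|rewrite IH; ring]. Qed.

Lemma rsum_minus (f g : nat -> R) n :
  rsum (fun k => f k - g k) n = rsum f n - rsum g n.
Proof. induction n as [|n IH]; simpl; [ring|rewrite IH; ring]. Qed.

Lemma rsum_const (a : R) n : rsum (fun _ => a) n = INR n * a.
Proof. induction n as [|n IH]; [simpl; ring|]. rewrite S_INR; simpl; rewrite IH; ring. Qed.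

Lemma rsum_le (f g : nat -> R) n :
  (forall k, (k < n)%nat -> f k <= g k) -> rsum f n <= rsum g n.
Proof.
  induction n as [|n IH]; intros H; simpl; [lra|].
  apply Rplus_le_compat; [apply IH; intros; apply H; lia|apply H; lia].
Qed.

Lemma rsum_Rabs (f : nat -> R) n : Rabs (rsum f n) <= rsum (fun k => Rabs (f k)) n.
Proof.
  induction n as [|n IH]; simpl; [rewrite Rabs_R0; lra|].
  eapply Rle_trans; [apply Rabs_triang|lra].
Qed.

Lemma rsum_app (f : nat -> R) n m :
  rsum f (n + m) = rsum f n + rsum (fun k => f (n + k)%nat) m.
Proof.
  induction m as [|m IH]; [rewrite Nat.add_0_r; simpl; ring|].
  rewrite Nat.add_succ_r; simpl; rewrite IH; ring.
Qed.

Lemma rsum_S_l (f : nat -> R) n : rsum f (S n) = f 0%nat + rsum (fun k => f (S k)) n.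
Proof. change (S n) with (1 + n)%nat. rewrite rsum_app; simpl; ring. Qed.

Lemma rsum_S_r (f : nat -> R) n : rsum f (S n) = rsum f n + f n.
Proof. reflexivity. Qed.

Lemma rsum_telescope (f : nat -> R) n : rsum (fun k => f (S k) - f k) n = f n - f 0%nat.
Proof. induction n as [|n IH]; simpl; [ring|rewrite IH; ring]. Qed.

Lemma rsum_rev (f : nat -> R) n : rsum f n = rsum (fun k => f (n - 1 - k)%nat) n.
Proof.
  induction n as [|n IH]; [reflexivity|].
  rewrite (rsum_S_l (fun k => f (S n - 1 - k)%nat)). simpl rsum at 1. rewrite IH.
  replace (S n - 1 - 0)%nat with n by lia.
  rewrite (rsum_ext (fun k => f (S n - 1 - S k)%nat) (fun k => f (n - 1 - k)%nat));
    [ring|intros k Hk; f_equal; lia].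
Qed.

Lemma sum_f_R0_rsum (f : nat -> R) n : sum_f_R0 f n = rsum f (S n).
Proof. induction n as [|n IH]; [simpl; ring|]. rewrite tech5, IH. reflexivity. Qed.

Lemma cos_plus_INR_PI x k : cos (x + INR k * PI) = (-1) ^ k * cos x.
Proof.
  induction k as [|k IH]; [simpl; rewrite Rmult_0_l, Rplus_0_r; ring|].
  rewrite S_INR. replace (x + (INR k + 1) * PI) with (x + INR k * PI + PI) by ring.
  rewrite neg_cos, IH; simpl; ring.
Qed.

Lemma sin_INR_PI k : sin (INR k * PI) = 0.
Proof. apply sin_eq_0_1. exists (Z.of_nat k). now rewrite INR_IZR_INZ. Qed.

Lemma pow_m1_sqr k : (-1) ^ k * (-1) ^ k = 1.
Proof. rewrite <- Rpow_mult_distr. replace (-1 * -1) with 1 by ring. apply pow1. Qed.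

Lemma Rabs_pow_m1 k : Rabs ((-1) ^ k) = 1.
Proof. apply pow_1_abs. Qed.

(** Each pair is 2 cos(b/2) cos((k + 1/2) b); multiplied by sin(b/2) it becomes cos(b/2) (sin((k+1)
    b) - sin(k b)), which telescopes. *)
Lemma sum_cos_pairs b n :
  rsum (fun k => cos (INR k * b) + cos (INR (S k) * b)) n * sin (b / 2)
  = cos (b / 2) * sin (INR n * b).
Proof.
  induction n as [|n IH].
  - simpl INR. rewrite (Rmult_0_l b), sin_0. simpl. ring.
  - cbn [rsum]. rewrite Rmult_plus_distr_r, IH, S_INR.
    set (m := INR n * b + b / 2).
    replace (INR n * b) with (m - b / 2) by (unfold m; field).
    replace ((INR n + 1) * b) with (m + b / 2) by (unfold m; field).
    rewrite sin_minus, sin_plus, cos_minus, cos_plus. ring.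
Qed.

(** * The alternating functional on the Chebyshev knots *)

Definition knot (s k : nat) : R := cos (INR k * PI / INR s).

(** For smooth [p] this is the integral over [-1,1] of the derivative of [p] against the sign of
    sin(s arccos u), which is (-1)^k between the knots of index k+1 and k. Written with increments,
    it also applies to functions with kinks. *)
Definition altf (s : nat) (p : R -> R) : R :=
  rsum (fun k => (-1) ^ k * (p (knot s k) - p (knot s (S k)))) s.

Lemma altf_ext s p q : (forall u, p u = q u) -> altf s p = altf s q.
Proof. intros H; apply rsum_ext; intros; now rewrite !H. Qed.

Lemma altf_minus s p q : altf s (fun u => p u - q u) = altf s p - altf s q.
Proof. unfold altf; rewrite <- rsum_minus; apply rsum_ext; intros; ring. Qed.

Lemma altf_scal s a p : altf s (fun u => a * p u) = a * altf s p.
Proof. unfold altf; rewrite <- rsum_scal; apply rsum_ext; intros; ring. Qed.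

(** Since (-1)^k cos x = cos(x + k pi), the alternating sign becomes a shift of the frequency by pi,
    and the difference becomes a sum because consecutive signs differ. *)
Lemma altf_cos s m : (0 < s)%nat ->
  rsum (fun k => (-1) ^ k * (cos (INR m * (INR k * PI / INR s))
                             - cos (INR m * (INR (S k) * PI / INR s)))) s
  = rsum (fun k => cos (INR k * (INR m * PI / INR s + PI))
                   + cos (INR (S k) * (INR m * PI / INR s + PI))) s.
Proof.
  intros Hs. assert (INR s <> 0) by (apply not_0_INR; lia).
  apply rsum_ext; intros k _.
  replace (INR k * (INR m * PI / INR s + PI))
    with (INR m * (INR k * PI / INR s) + INR k * PI) by (field; assumption).
  replace (INR (S k) * (INR m * PI / INR s + PI))
    with (INR m * (INR (S k) * PI / INR s) + INR (S k) * PI) by (field; assumption).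
  rewrite !cos_plus_INR_PI. simpl; ring.
Qed.


(** The moment of u^n T_m(u), where T_m is the Chebyshev polynomial: its value at a knot is cos(m k
    pi / s). The product formula for cosines trades one power of u for shifts of m by one, so that
    power moments reduce to the case n = 0. *)
Definition altcos (s n m : nat) : R :=
  rsum (fun k => (-1) ^ k *
     (knot s k ^ n * cos (INR m * (INR k * PI / INR s))
      - knot s (S k) ^ n * cos (INR m * (INR (S k) * PI / INR s)))) s.

Lemma altcos_0 s m : (0 < s)%nat ->
  altcos s 0 m = rsum (fun k => cos (INR k * (INR m * PI / INR s + PI))
                   + cos (INR (S k) * (INR m * PI / INR s + PI))) s.
Proof.
  intros Hs. rewrite <- altf_cos by assumption.
  apply rsum_ext; intros; simpl pow; ring.
Qed.

(** In the closed form with b = m pi/s + pi, the factor sin(s b) = sin((m + s) pi) vanishes, while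
    sin(b/2) is nonzero because m < s. *)
Lemma altcos_0_lt s m : (m < s)%nat -> altcos s 0 m = 0.
Proof.
  intros Hm. rewrite altcos_0 by lia.
  assert (Hs0 : 0 < INR s) by (apply lt_0_INR; lia).
  assert (Hm' : INR m < INR s) by now apply lt_INR.
  assert (Hc : 0 < sin ((INR m * PI / INR s + PI) / 2)).
  { pose proof PI_RGT_0. pose proof (pos_INR m).
    assert (0 <= INR m / INR s < 1).
    { split; [apply Rmult_le_pos; [lra|left; now apply Rinv_0_lt_compat]|].
      apply Rmult_lt_reg_r with (INR s); [lra|].
      unfold Rdiv; rewrite Rmult_assoc, Rinv_l by lra; lra. }
    replace ((INR m * PI / INR s + PI) / 2) with ((INR m / INR s + 1) * PI / 2)
      by (field; lra).
    apply sin_gt_0; nra. }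
  apply Rmult_eq_reg_r with (sin ((INR m * PI / INR s + PI) / 2)); [|lra].
  rewrite sum_cos_pairs, Rmult_0_l.
  replace (INR s * (INR m * PI / INR s + PI)) with (INR (m + s) * PI)
    by (rewrite plus_INR; field; lra).
  rewrite sin_INR_PI; ring.
Qed.

Lemma altcos_0_eq s : (0 < s)%nat -> altcos s 0 s = 2 * INR s.
Proof.
  intros Hs. rewrite altcos_0 by lia.
  assert (Hs0 : 0 < INR s) by now apply lt_0_INR.
  rewrite (rsum_ext _ (fun _ => 2)); [rewrite rsum_const; ring|].
  intros k _. replace (INR s * PI / INR s + PI) with (2 * PI) by (field; lra).
  assert (E : forall j, cos (INR j * (2 * PI)) = 1).
  { intros j. replace (INR j * (2 * PI)) with (0 + 2 * INR j * PI) by ring.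
    rewrite cos_period. apply cos_0. }
  rewrite !E; ring.
Qed.

Lemma altcos_S s n m :
  altcos s (S n) (S m) = / 2 * altcos s n (S (S m)) + / 2 * altcos s n m.
Proof.
  unfold altcos. rewrite <- !rsum_scal, <- rsum_plus. apply rsum_ext; intros k _.
  assert (prod : forall k, knot s k ^ S n * cos (INR (S m) * (INR k * PI / INR s))
     = / 2 * (knot s k ^ n * cos (INR (S (S m)) * (INR k * PI / INR s)))
       + / 2 * (knot s k ^ n * cos (INR m * (INR k * PI / INR s)))).
  { intros j. unfold knot. set (a := INR j * PI / INR s).
    rewrite !S_INR. set (b := (INR m + 1) * a).
    replace ((INR m + 1 + 1) * a) with (b + a) by (unfold b; ring).
    replace (INR m * a) with (b - a) by (unfold b; ring).
    rewrite cos_plus, cos_minus. simpl. field. }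
  rewrite !prod. ring.
Qed.

Lemma altcos_S0 s n : altcos s (S n) 0 = altcos s n 1.
Proof.
  unfold altcos. apply rsum_ext; intros k _. change (INR 0) with 0. change (INR 1) with 1.
  rewrite !Rmult_0_l, !Rmult_1_l, cos_0. unfold knot. cbn [pow]. ring.
Qed.

Lemma altcos_lt s n : forall m, (m + n < s)%nat -> altcos s n m = 0.
Proof.
  induction n as [|n IH]; intros m Hm; [apply altcos_0_lt; lia|].
  destruct m as [|m]; [rewrite altcos_S0; apply IH; lia|].
  rewrite altcos_S, !IH by lia. ring.
Qed.

(** The leading Chebyshev term of u^n T_m is 2^(-n) T_(m+n), and the other terms have index below s.
    The order is a successor because u T_0 = T_1 brings no factor 1/2. *)
Lemma altcos_eq s n : forall m, (S m + n = s)%nat -> altcos s n (S m) = 2 * INR s / 2 ^ n.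
Proof.
  induction n as [|n IH]; intros m Hm.
  - replace (S m) with s by lia. rewrite altcos_0_eq by lia. simpl; field.
  - rewrite altcos_S, IH, altcos_lt by lia. simpl. field. apply pow_nonzero; lra.
Qed.

Lemma altf_pow_altcos s n : altf s (fun u => u ^ n) = altcos s n 0.
Proof.
  apply rsum_ext; intros k _. simpl INR. rewrite !Rmult_0_l, cos_0. ring.
Qed.

Lemma altf_pow_lt s n : (n < s)%nat -> altf s (fun u => u ^ n) = 0.
Proof. intros H. rewrite altf_pow_altcos. apply altcos_lt; lia. Qed.

Lemma altf_pow_eq s : (0 < s)%nat -> altf s (fun u => u ^ s) = 2 * INR s / 2 ^ (s - 1).
Proof.
  intros H. rewrite altf_pow_altcos. destruct s as [|n]; [lia|].
  rewrite altcos_S0. replace (S n - 1)%nat with n by lia. apply altcos_eq; lia.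
Qed.

Lemma altf_shift_lt s x b : forall a, (a + b < s)%nat ->
  altf s (fun u => u ^ a * (x - u) ^ b) = 0.
Proof.
  induction b as [|b IH]; intros a H.
  - rewrite (altf_ext _ _ (fun u => u ^ a)) by (intros; simpl; ring).
    apply altf_pow_lt; lia.
  - rewrite (altf_ext _ _ (fun u => x * (u ^ a * (x - u) ^ b) - u ^ S a * (x - u) ^ b))
      by (intros; simpl; ring).
    rewrite altf_minus, altf_scal, !IH by lia. ring.
Qed.

Lemma altf_shift_eq s x b : forall a, (a + b = s)%nat ->
  altf s (fun u => u ^ a * (x - u) ^ b) = (-1) ^ b * altf s (fun u => u ^ s).
Proof.
  induction b as [|b IH]; intros a H.
  - assert (a = s) as -> by lia. rewrite (pow_O (-1)), Rmult_1_l.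
    apply altf_ext; intros; simpl; ring.
  - rewrite (altf_ext _ _ (fun u => x * (u ^ a * (x - u) ^ b) - u ^ S a * (x - u) ^ b))
      by (intros; simpl; ring).
    rewrite altf_minus, altf_scal, altf_shift_lt, IH by lia. simpl. ring.
Qed.

Lemma knot_0 s : knot s 0 = 1.
Proof. unfold knot. simpl. unfold Rdiv. rewrite !Rmult_0_l. apply cos_0. Qed.

Lemma knot_last s : (0 < s)%nat -> knot s s = -1.
Proof.
  intros H. unfold knot. replace (INR s * PI / INR s) with PI.
  - apply cos_PI.
  - field. apply not_0_INR; lia.
Qed.

Lemma knot_angle s k : (k <= s)%nat -> (0 < s)%nat -> 0 <= INR k * PI / INR s <= PI.
Proof.
  intros Hk Hs. assert (0 < INR s) by now apply lt_0_INR.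
  assert (INR k <= INR s) by now apply le_INR.
  pose proof (pos_INR k). pose proof PI_RGT_0. split.
  - apply Rmult_le_pos; [nra|left; now apply Rinv_0_lt_compat].
  - apply Rmult_le_reg_r with (INR s); [lra|].
    unfold Rdiv; rewrite Rmult_assoc, Rinv_l by lra; nra.
Qed.

Lemma knot_le s k : (S k <= s)%nat -> knot s (S k) <= knot s k.
Proof.
  intros H. assert (0 < INR s) by (apply lt_0_INR; lia).
  left; apply cos_decreasing_1; try (apply knot_angle; lia).
  apply Rmult_lt_compat_r; [now apply Rinv_0_lt_compat|].
  apply Rmult_lt_compat_r; [apply PI_RGT_0|apply lt_INR; lia].
Qed.

Lemma knot_antitone s j k : (j <= k)%nat -> (k <= s)%nat -> knot s k <= knot s j.
Proof.
  intros H. induction H as [|k H IH]; intros Hs; [lra|].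
  eapply Rle_trans; [apply knot_le; lia|apply IH; lia].
Qed.

Lemma knot_bound s k : -1 <= knot s k <= 1.
Proof. apply COS_bound. Qed.

Lemma knot_opp s k : (k <= s)%nat -> (0 < s)%nat -> knot s (s - k) = - knot s k.
Proof.
  intros Hk Hs. unfold knot. rewrite minus_INR by assumption.
  replace ((INR s - INR k) * PI / INR s) with (- (INR k * PI / INR s) + PI)
    by (field; apply not_0_INR; lia).
  rewrite neg_cos, cos_neg. reflexivity.
Qed.

(** The reflection k -> s - k of the knots reverses each increment, and for even [s] it also
    reverses the sign attached to it; the two signs cancel. *)
Lemma altf_opp s p : Nat.Even s -> (0 < s)%nat -> altf s (fun u => p (- u)) = altf s p.
Proof.
  intros [m Hm] Hs. unfold altf. rewrite (rsum_rev _ s) at 1. apply rsum_ext; intros k Hk.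
  replace (S (s - 1 - k)) with (s - k)%nat by lia.
  replace (s - 1 - k)%nat with (s - S k)%nat by lia.
  rewrite !knot_opp by lia. rewrite !Ropp_involutive.
  replace ((-1) ^ (s - S k)) with (- (-1) ^ k); [ring|].
  assert (E : (-1) ^ (s - S k) * (-1) ^ (S k) = 1).
  { rewrite <- pow_add. replace (s - S k + S k)%nat with (2 * m)%nat by lia. apply pow_1_even. }
  pose proof (pow_m1_sqr k) as Hsq. simpl in E.
  set (e := (-1) ^ (s - S k)) in *. set (w := (-1) ^ k) in *.
  transitivity (e * w * w); [replace (e * w) with (-1) by lra; ring|].
  rewrite Rmult_assoc, Hsq; ring.
Qed.

(** * Truncated powers and the perfect B-spline *)

Definition ppart (x : R) : R := Rmax 0 x.

Lemma ppart_of_nonneg x : 0 <= x -> ppart x = x.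
Proof. intros; apply Rmax_right; assumption. Qed.

Lemma ppart_of_nonpos x : x <= 0 -> ppart x = 0.
Proof. intros; apply Rmax_left; assumption. Qed.

Lemma ppart_pow_S x p : ppart x ^ S (S p) = x * ppart x ^ S p.
Proof.
  destruct (Rle_dec 0 x).
  - rewrite ppart_of_nonneg by assumption. reflexivity.
  - rewrite ppart_of_nonpos by lra. simpl. ring.
Qed.

(** For the square, the increment differs from its linear part by at most h^2, also across the kink
    at 0. Higher powers follow by the product rule, since multiplying a truncated power by x raises
    its exponent. *)
Lemma derivable_ppart_pow p x :
  derivable_pt_lim (fun x => ppart x ^ S (S p)) x (INR (S (S p)) * ppart x ^ S p).
Proof.
  revert x. induction p as [|p IH]; intros x.
  - intros eps Heps. exists (mkposreal eps Heps). intros h Hh Hlt. simpl in Hlt.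
    assert (Hb : Rabs (ppart (x + h) ^ 2 - ppart x ^ 2 - INR 2 * ppart x ^ 1 * h) <= h * h).
    { simpl. destruct (Rle_dec 0 x), (Rle_dec 0 (x + h));
        rewrite ?(ppart_of_nonneg x), ?(ppart_of_nonneg (x + h)),
                ?(ppart_of_nonpos x), ?(ppart_of_nonpos (x + h)) by lra;
        apply Rabs_le; split; nra. }
    replace ((ppart (x + h) ^ 2 - ppart x ^ 2) / h - INR 2 * ppart x ^ 1)
      with ((ppart (x + h) ^ 2 - ppart x ^ 2 - INR 2 * ppart x ^ 1 * h) / h)
      by (field; assumption).
    unfold Rdiv. rewrite Rabs_mult, Rabs_inv.
    assert (0 < Rabs h) by now apply Rabs_pos_lt.
    apply Rle_lt_trans with (Rabs h); [|assumption].
    apply Rmult_le_reg_r with (Rabs h); [assumption|].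
    rewrite Rmult_assoc, Rinv_l, Rmult_1_r by lra.
    rewrite <- Rabs_mult, (Rabs_right (h * h)) by nra. exact Hb.
  - replace (INR (S (S (S p))) * ppart x ^ S (S p))
      with (1 * ppart x ^ S (S p) + x * (INR (S (S p)) * ppart x ^ S p))
      by (rewrite (S_INR (S (S p))), (ppart_pow_S x p); ring).
    apply (derivable_pt_lim_ext (fun x => x * ppart x ^ S (S p))).
    { intros z. symmetry. apply ppart_pow_S. }
    apply (derivable_pt_lim_mult (fun x => x) (fun x => ppart x ^ S (S p)) x 1
             (INR (S (S p)) * ppart x ^ S p)); [apply derivable_pt_lim_id|apply IH].
Qed.

(* [q = 0], [p = s - 1] is the perfect B-spline; the factors [u ^ q] arise from
   multiplying it by powers of [x = (x - u) + u]. *)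
Definition tspl (s q p : nat) (x : R) : R :=
  altf s (fun u => u ^ q * ppart (x - u) ^ p) / INR (fact p).

Lemma derivable_rsum (f : nat -> R -> R) (f' : nat -> R) x n :
  (forall k, derivable_pt_lim (f k) x (f' k)) ->
  derivable_pt_lim (fun x => rsum (fun k => f k x) n) x (rsum f' n).
Proof.
  intros H. induction n as [|n IH]; simpl.
  - apply derivable_pt_lim_const.
  - now apply (derivable_pt_lim_plus (fun x => rsum (fun k => f k x) n) (f n)).
Qed.

Lemma derivable_altf s (f : R -> R -> R) (f' : R -> R) x :
  (forall u, derivable_pt_lim (f u) x (f' u)) ->
  derivable_pt_lim (fun x => altf s (fun u => f u x)) x (altf s f').
Proof.
  intros H. unfold altf.
  apply (derivable_rsum (fun k x => (-1) ^ k * (f (knot s k) x - f (knot s (S k)) x))).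
  intros k. apply (derivable_pt_lim_scal (fun x => f (knot s k) x - f (knot s (S k)) x)).
  now apply (derivable_pt_lim_minus (f (knot s k)) (f (knot s (S k)))).
Qed.

Lemma derivable_tspl s q p x :
  derivable_pt_lim (tspl s q (S (S p))) x (tspl s q (S p) x).
Proof.
  unfold tspl.
  apply (derivable_pt_lim_ext
    (fun x => altf s (fun u => u ^ q * ppart (x - u) ^ S (S p) / INR (fact (S (S p)))))).
  { intros z. unfold Rdiv. rewrite (Rmult_comm (altf _ _)), <- altf_scal.
    apply altf_ext; intros; ring. }
  replace (altf s (fun u => u ^ q * ppart (x - u) ^ S p) / INR (fact (S p)))
    with (altf s (fun u => u ^ q * (/ INR (fact (S (S p))) *
                             (INR (S (S p)) * ppart (x - u) ^ S p * 1)))).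
  2:{ unfold Rdiv. rewrite (Rmult_comm (altf s _)), <- altf_scal. apply altf_ext; intros u.
      rewrite (fact_simpl (S p)), mult_INR. field.
      split; [apply INR_fact_neq_0|apply not_0_INR; lia]. }
  apply (derivable_altf s (fun u x => u ^ q * ppart (x - u) ^ S (S p) / INR (fact (S (S p))))).
  intros u.
  apply (derivable_pt_lim_ext
           (fun x => u ^ q * (/ INR (fact (S (S p))) * ppart (x - u) ^ S (S p)))).
  { intros z. unfold Rdiv. ring. }
  apply (derivable_pt_lim_scal (fun x => / INR (fact (S (S p))) * ppart (x - u) ^ S (S p))).
  apply (derivable_pt_lim_scal (fun x => ppart (x - u) ^ S (S p))).
  apply (derivable_pt_lim_comp (fun x => x - u) (fun x => ppart x ^ S (S p))).
  - replace 1 with (1 - 0) by ring.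
    apply (derivable_pt_lim_minus (fun x => x) (fun _ => u));
      [apply derivable_pt_lim_id|apply derivable_pt_lim_const].
  - apply derivable_ppart_pow.
Qed.

Lemma altf_zero s p : (forall k, (k <= s)%nat -> p (knot s k) = 0) -> altf s p = 0.
Proof.
  intros H. unfold altf. rewrite (rsum_ext _ (fun _ => 0)); [rewrite rsum_const; ring|].
  intros k Hk. rewrite !H by lia. ring.
Qed.

Lemma altf_ext_knots s p q :
  (forall k, (k <= s)%nat -> p (knot s k) = q (knot s k)) -> altf s p = altf s q.
Proof. intros H; apply rsum_ext; intros; rewrite !H by lia; reflexivity. Qed.

Lemma tspl_left s q p x : x <= -1 -> tspl s q (S p) x = 0.
Proof.
  intros H. unfold tspl. rewrite altf_zero; [unfold Rdiv; ring|].
  intros k _. pose proof (knot_bound s k). rewrite ppart_of_nonpos by lra. simpl; ring.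
Qed.

Lemma tspl_right s q p x : 1 <= x ->
  tspl s q p x = altf s (fun u => u ^ q * (x - u) ^ p) / INR (fact p).
Proof.
  intros H. unfold tspl. f_equal. apply altf_ext_knots; intros k _.
  pose proof (knot_bound s k). rewrite ppart_of_nonneg by lra. reflexivity.
Qed.

Lemma tspl_right_0 s q p x : (q + p < s)%nat -> 1 <= x -> tspl s q p x = 0.
Proof.
  intros H Hx. rewrite tspl_right by assumption. rewrite altf_shift_lt by lia.
  unfold Rdiv; ring.
Qed.

(** For odd p the truncated powers of w and -w differ by the polynomial w^p, which the alternating
    functional annihilates in degree below [s]; [altf_opp] does the rest. *)
Lemma tspl_even s p x : Nat.Even s -> Nat.Odd p -> (p < s)%nat ->
  tspl s 0 p (- x) = tspl s 0 p x.
Proof.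
  intros He [m Hm] Hp. unfold tspl. f_equal.
  rewrite <- (altf_opp s (fun u => u ^ 0 * ppart (- x - u) ^ p)) by (assumption || lia).
  apply Rminus_diag_uniq. rewrite <- altf_minus.
  rewrite (altf_ext _ _ (fun u => -1 * (u ^ 0 * (x - u) ^ p))).
  { rewrite altf_scal, altf_shift_lt by lia. ring. }
  intros u. replace (- x - - u) with (- (x - u)) by ring. set (w := x - u). simpl.
  assert (Hodd : (- w) ^ p = - w ^ p).
  { replace (- w) with (-1 * w) by ring. rewrite Rpow_mult_distr, Hm.
    replace (2 * m + 1)%nat with (S (2 * m)) by lia. rewrite pow_1_odd. ring. }
  destruct p as [|p]; [lia|].
  destruct (Rle_dec 0 w).
  - rewrite (ppart_of_nonpos (- w)), (ppart_of_nonneg w) by lra. rewrite pow_i by lia. ring.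
  - rewrite (ppart_of_nonneg (- w)), (ppart_of_nonpos w) by lra. rewrite pow_i, Hodd by lia. ring.
Qed.

Lemma tspl_mul_x s q p x :
  x * tspl s q (S p) x = INR (S (S p)) * tspl s q (S (S p)) x + tspl s (S q) (S p) x.
Proof.
  unfold tspl.
  assert (E : altf s (fun u => u ^ S q * ppart (x - u) ^ S p)
            = x * altf s (fun u => u ^ q * ppart (x - u) ^ S p)
              - altf s (fun u => u ^ q * ppart (x - u) ^ S (S p))).
  { rewrite <- altf_scal, <- altf_minus. apply altf_ext; intros u.
    rewrite ppart_pow_S. simpl. ring. }
  rewrite E, (fact_simpl (S p)), mult_INR. field.
  split; [apply INR_fact_neq_0|apply not_0_INR; lia].
Qed.


(** * The integral definition of the B-spline in truncated powers *)

Lemma RInt_of_is_RInt (f : R -> R) a b v : is_RInt f a b v -> RInt f a b = v.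
Proof.
  intros H. pose proof (ex_RInt_Reals_0 f a b (ex_intro _ v H)) as pr.
  unfold RInt. destruct (excluded_middle_informative _) as [E|E].
  - destruct (constructive_indefinite_description _ E) as [w [pr' Hw]]. simpl.
    rewrite <- Hw, <- RInt_Reals. now apply is_RInt_unique.
  - exfalso. apply E. now exists (RiemannInt pr), pr.
Qed.

Lemma is_RInt_zero (f : R -> R) a b : a <= b ->
  (forall t, a < t < b -> f t = 0) -> is_RInt f a b 0.
Proof.
  intros Hab H. replace 0 with ((b - a) * 0) by ring.
  apply (is_RInt_ext (fun _ => 0)).
  - intros t Ht. rewrite Rmin_left, Rmax_right in Ht by lra. symmetry; now apply H.
  - apply (is_RInt_const a b 0).
Qed.

(** The integrand lives on [a,b] cut off at x; with a and b replaced by their minima with x, the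
    truncated powers become ordinary ones and the integral is elementary. *)
Lemma is_RInt_chi_pow lo a b x n : lo <= a -> a <= b -> lo <= x ->
  is_RInt (fun t => chi a b t * (x - t) ^ n) lo x
    ((ppart (x - a) ^ S n - ppart (x - b) ^ S n) / INR (S n)).
Proof.
  intros Hla Hab Hlx. assert (Hn : INR (S n) <> 0) by (apply not_0_INR; lia).
  set (a' := Rmin a x). set (b' := Rmin b x).
  assert (Ha : ppart (x - a) = x - a').
  { unfold a', ppart, Rmin, Rmax. destruct (Rle_dec a x), (Rle_dec 0 (x - a)); lra. }
  assert (Hb : ppart (x - b) = x - b').
  { unfold b', ppart, Rmin, Rmax. destruct (Rle_dec b x), (Rle_dec 0 (x - b)); lra. }
  assert (H1 : lo <= a' /\ a' <= b' /\ b' <= x /\ a' <= a /\ b' <= b /\ (b' < x -> b' = b)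
               /\ (a' < x -> a' = a)).
  { unfold a', b', Rmin. destruct (Rle_dec a x), (Rle_dec b x); lra. }
  destruct H1 as (H1 & H2 & H3 & H4 & H5 & H6 & H7).
  rewrite Ha, Hb.
  replace (((x - a') ^ S n - (x - b') ^ S n) / INR (S n))
    with (0 + (((x - a') ^ S n - (x - b') ^ S n) / INR (S n) + 0)) by ring.
  set (v := ((x - a') ^ S n - (x - b') ^ S n) / INR (S n)).
  apply (@is_RInt_Chasles R_NormedModule _ lo a' x 0 (v + 0)).
  { apply is_RInt_zero; [assumption|]. intros t Ht. unfold chi.
    destruct (Rlt_dec a t); [lra|ring]. }
  apply (@is_RInt_Chasles R_NormedModule _ a' b' x v 0).
  2:{ apply is_RInt_zero; [assumption|]. intros t Ht. unfold chi.
      destruct (Rlt_dec a t); [|ring]. destruct (Rle_dec t b); [|ring].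
      rewrite H6 in Ht; lra. }
  apply (is_RInt_ext (fun t => (x - t) ^ n)).
  { intros t Ht. rewrite Rmin_left, Rmax_right in Ht by lra. unfold chi.
    rewrite H7 in Ht by lra.
    destruct (Rlt_dec a t); [|lra]. destruct (Rle_dec t b); [now rewrite Rmult_1_l|lra]. }
  replace v with (- (x - b') ^ S n / INR (S n) - - (x - a') ^ S n / INR (S n))
    by (unfold v; field; assumption).
  apply (@is_RInt_derive R_CompleteNormedModule (fun t => - (x - t) ^ S n / INR (S n))).
  - intros t _. auto_derive; [trivial|].
    replace (x + - t) with (x - t) by ring. field. assumption.
  - intros t _. apply (ex_derive_continuous (fun t => (x - t) ^ n)). auto_derive. trivial.
Qed.

Lemma is_RInt_rsum (f : nat -> R -> R) (v : nat -> R) a b n :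
  (forall k, (k < n)%nat -> is_RInt (f k) a b (v k)) ->
  is_RInt (fun t => rsum (fun k => f k t) n) a b (rsum v n).
Proof.
  induction n as [|n IH]; intros H; simpl.
  - evar_last; [apply (is_RInt_const a b 0)|]. apply Rmult_0_r.
  - apply (@is_RInt_plus R_NormedModule (fun t => rsum (fun k => f k t) n) (f n) a b
             (rsum v n) (v n)).
    + apply IH; intros; apply H; lia.
    + apply H; lia.
Qed.

(** Each step of the sign function integrates to a difference of truncated powers at two consecutive
    knots. The factor (-1)^(s-1) = -1 puts this difference in the order used by [altf]. To the right
    of 1, where [gspline] is zero by definition, the truncated powers form a polynomial of degree s
    - 1, which is annihilated. *)
Lemma gspline_tspl s x : (2 <= s)%nat -> Nat.Even s -> gspline s x = tspl s 0 (s - 1) x.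
Proof.
  intros Hs He. unfold gspline.
  destruct (Rle_dec (-1) x) as [H1|H1].
  2:{ destruct s as [|[|s]]; try lia. replace (S (S s) - 1)%nat with (S s) by lia.
      rewrite tspl_left by lra; reflexivity. }
  destruct (Rle_dec x 1) as [H2|H2]; [|rewrite tspl_right_0 by (lia || lra); reflexivity].
  rewrite (RInt_of_is_RInt _ _ _
    (rsum (fun k => (-1) ^ k * ((ppart (x - knot s (S k)) ^ S (s - 2)
                                 - ppart (x - knot s k) ^ S (s - 2)) / INR (S (s - 2)))) s)).
  - replace (S (s - 2)) with (s - 1)%nat by lia.
    unfold tspl, altf, Rdiv. rewrite Rmult_assoc, <- rsum_scal.
    rewrite (Rmult_comm (rsum _ s)), <- !rsum_scal. apply rsum_ext; intros k _.
    destruct He as [m Hm]. destruct s as [|[|n]]; try lia.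
    replace (S (S n) - 1)%nat with (S n) by lia. replace (S (S n) - 2)%nat with n by lia.
    replace (S n) with (S (2 * (m - 1))) at 1 by lia. rewrite pow_1_odd.
    rewrite (fact_simpl n), mult_INR. cbn [pow]. field.
    split; [apply INR_fact_neq_0|apply not_0_INR; lia].
  - apply (is_RInt_ext (fun t => rsum (fun k => (-1) ^ k *
         (chi (knot s (S k)) (knot s k) t * (x - t) ^ (s - 2))) s)).
    { intros t _. rewrite sum_f_R0_rsum. replace (S (s - 1)) with s by lia.
      apply rsum_ext; intros k _. unfold knot. rewrite (Nat.add_1_r k). ring. }
    apply (is_RInt_rsum (fun k t => (-1) ^ k *
         (chi (knot s (S k)) (knot s k) t * (x - t) ^ (s - 2)))).
    intros k Hk. apply (@is_RInt_scal R_NormedModule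
             (fun t => chi (knot s (S k)) (knot s k) t * (x - t) ^ (s - 2))).
    apply is_RInt_chi_pow; [apply knot_bound|apply knot_le; lia|assumption].
Qed.


(** * Variation of iterated differences *)

Definition diff (h : R) (f : R -> R) (x : R) : R := f (x + h) - f x.

Fixpoint diffn (n : nat) (h : R) (f : R -> R) : R -> R :=
  match n with O => f | S m => diff h (diffn m h f) end.

(* For smooth [f] and [n >= 1], the best [V] is about [h^(n-1)] times the total
   variation of the [(n-1)]-st derivative of [f]. *)
Definition vbound (n : nat) (h : R) (f : R -> R) (V : R) : Prop :=
  forall c K, rsum (fun k => Rabs (diffn n h f (c + INR k * h))) K <= V.

Lemma diffn_ext n h f g : (forall x, f x = g x) -> forall x, diffn n h f x = diffn n h g x.
Proof.
  intros H; induction n as [|n IH]; intros x; simpl; [apply H|].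
  unfold diff; now rewrite !IH.
Qed.

Lemma diffn_plus n h f g x :
  diffn n h (fun x => f x + g x) x = diffn n h f x + diffn n h g x.
Proof.
  revert x; induction n as [|n IH]; intros x; simpl; [reflexivity|].
  unfold diff; rewrite !IH; ring.
Qed.

Lemma diffn_scal n h a f x : diffn n h (fun x => a * f x) x = a * diffn n h f x.
Proof.
  revert x; induction n as [|n IH]; intros x; simpl; [reflexivity|].
  unfold diff; rewrite !IH; ring.
Qed.

Lemma vbound_ext n h f g V : (forall x, f x = g x) -> vbound n h f V -> vbound n h g V.
Proof.
  intros H Hf c K. eapply Rle_trans; [right|apply (Hf c K)].
  apply rsum_ext; intros. f_equal. now apply diffn_ext.
Qed.

Lemma vbound_weaken n h f V V' : V <= V' -> vbound n h f V -> vbound n h f V'.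
Proof. intros H Hf c K. eapply Rle_trans; [apply Hf|exact H]. Qed.

Lemma vbound_plus n h f g V W :
  vbound n h f V -> vbound n h g W -> vbound n h (fun x => f x + g x) (V + W).
Proof.
  intros Hf Hg c K. eapply Rle_trans; [|apply Rplus_le_compat; [apply (Hf c K)|apply (Hg c K)]].
  rewrite <- rsum_plus. apply rsum_le; intros. rewrite diffn_plus. apply Rabs_triang.
Qed.

Lemma vbound_scal n h a f V :
  vbound n h f V -> vbound n h (fun x => a * f x) (Rabs a * V).
Proof.
  intros Hf c K. eapply Rle_trans; [|apply Rmult_le_compat_l; [apply Rabs_pos|apply (Hf c K)]].
  rewrite <- rsum_scal. apply rsum_le; intros. rewrite diffn_scal, Rabs_mult. lra.
Qed.

Lemma vbound_rsum n h (f : nat -> R -> R) (V : nat -> R) m :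
  (forall k, (k < m)%nat -> vbound n h (f k) (V k)) ->
  vbound n h (fun x => rsum (fun k => f k x) m) (rsum V m).
Proof.
  induction m as [|m IH]; intros H; simpl.
  - apply (vbound_ext _ _ (fun x => 0 * 0)); [intros; ring|]. intros c K.
    apply Rle_trans with (rsum (fun _ => 0) K); [|rewrite rsum_const; lra].
    apply rsum_le; intros. rewrite (diffn_scal n h 0 (fun _ => 0)), Rmult_0_l, Rabs_R0. lra.
  - apply (vbound_plus n h (fun x => rsum (fun k => f k x) m) (f m)).
    + apply IH; intros; apply H; lia.
    + apply H; lia.
Qed.

Lemma derivable_shift f f' c x :
  (forall x, derivable_pt_lim f x (f' x)) -> derivable_pt_lim (fun x => f (x + c)) x (f' (x + c)).
Proof.
  intros H. replace (f' (x + c)) with (f' (x + c) * (1 + 0)) by ring.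
  apply (derivable_pt_lim_comp (fun x => x + c) f); [|apply H].
  apply (derivable_pt_lim_plus (fun x => x) (fun _ => c));
    [apply derivable_pt_lim_id|apply derivable_pt_lim_const].
Qed.

Lemma derivable_diffn n h f f' :
  (forall x, derivable_pt_lim f x (f' x)) ->
  forall x, derivable_pt_lim (diffn n h f) x (diffn n h f' x).
Proof.
  intros H; induction n as [|n IH]; intros x; simpl; [apply H|].
  apply (derivable_pt_lim_minus (fun x => diffn n h f (x + h)) (diffn n h f)); [|apply IH].
  now apply (derivable_shift (diffn n h f) (diffn n h f')).
Qed.

(** With the signs of the differences frozen as [e], the sum of absolute values is the increment of
    one function [Psi] over a step h. The mean value theorem then yields a single point xi for all
    terms, so the derivative is again sampled along an arithmetic progression. *)
Lemma vbound_derive n h f f' V : 0 < h ->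
  (forall x, derivable_pt_lim f x (f' x)) -> vbound n h f' V -> vbound (S n) h f (h * V).
Proof.
  intros Hh Hd Hb c K.
  set (e := fun k => if Rle_dec 0 (diffn (S n) h f (c + INR k * h)) then 1 else -1).
  set (Psi := fun z => rsum (fun k => e k * diffn n h f (z + INR k * h)) K).
  set (Psi' := fun z => rsum (fun k => e k * diffn n h f' (z + INR k * h)) K).
  assert (E : rsum (fun k => Rabs (diffn (S n) h f (c + INR k * h))) K = Psi (c + h) - Psi c).
  { unfold Psi. rewrite <- rsum_minus. apply rsum_ext; intros k _.
    replace (c + h + INR k * h) with (c + INR k * h + h) by ring.
    rewrite <- Rmult_minus_distr_l.
    change (diffn n h f (c + INR k * h + h) - diffn n h f (c + INR k * h))
      with (diffn (S n) h f (c + INR k * h)).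
    unfold e. destruct (Rle_dec 0 _); [rewrite Rabs_right by lra|rewrite Rabs_left by lra]; ring. }
  destruct (MVT_cor2 Psi Psi' c (c + h)) as [xi [Hxi _]]; [lra| |].
  { intros z _.
    apply (derivable_rsum (fun k z => e k * diffn n h f (z + INR k * h))). intros k.
    apply (derivable_pt_lim_scal (fun z => diffn n h f (z + INR k * h))).
    apply (derivable_shift (diffn n h f) (diffn n h f')). now apply derivable_diffn. }
  rewrite E, Hxi. replace (c + h - c) with h by ring. rewrite Rmult_comm.
  apply Rmult_le_compat_l; [lra|].
  eapply Rle_trans; [apply Rle_abs|]. eapply Rle_trans; [apply rsum_Rabs|].
  eapply Rle_trans; [|apply (Hb xi K)]. apply rsum_le; intros k _.
  rewrite Rabs_mult. unfold e. destruct (Rle_dec 0 _);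
    [rewrite Rabs_R1|rewrite Rabs_left by lra]; lra.
Qed.

Lemma vbound_dominated h f Phi lo hi : 0 < h ->
  (forall a b, a <= b -> Rabs (f b - f a) <= Phi b - Phi a) ->
  (forall x, lo <= Phi x <= hi) -> vbound 1 h f (hi - lo).
Proof.
  intros Hh Hd HP c K.
  apply Rle_trans with (rsum (fun k => Phi (c + INR (S k) * h) - Phi (c + INR k * h)) K).
  - apply rsum_le; intros k _. simpl diffn. unfold diff.
    replace (c + INR k * h + h) with (c + INR (S k) * h) by (rewrite S_INR; ring).
    apply Hd. rewrite S_INR. lra.
  - rewrite (rsum_telescope (fun k => Phi (c + INR k * h))).
    pose proof (HP (c + INR K * h)). pose proof (HP (c + INR 0 * h)). lra.
Qed.

(** The first difference of a ramp rises monotonically from 0 to h. *)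
Lemma vbound_ppart h u : 0 < h -> vbound 2 h (fun x => ppart (x - u)) h.
Proof.
  intros Hh. change (vbound 1 h (diff h (fun x => ppart (x - u))) h).
  replace h with (h - 0) at 3 by ring.
  apply (vbound_dominated h _ (diff h (fun x => ppart (x - u)))); [assumption| |].
  - intros a b Hab. right. apply Rabs_right. unfold diff, ppart, Rmax.
    repeat destruct (Rle_dec _ _); lra.
  - intros x. unfold diff, ppart, Rmax. repeat destruct (Rle_dec _ _); lra.
Qed.

Lemma vbound_tspl_1 s q h : 0 < h ->
  vbound 2 h (tspl s q 1)
    (h * rsum (fun k => Rabs (knot s k) ^ q + Rabs (knot s (S k)) ^ q) s).
Proof.
  intros Hh. rewrite <- rsum_scal.
  apply (vbound_ext _ _ (fun x => rsum (fun k => (-1) ^ k *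
    (knot s k ^ q * ppart (x - knot s k) + - knot s (S k) ^ q * ppart (x - knot s (S k)))) s)).
  { intros x. unfold tspl, altf. simpl (fact 1). simpl (INR 1). unfold Rdiv.
    rewrite Rinv_1, Rmult_1_r. apply rsum_ext; intros; ring. }
  apply (vbound_rsum 2 h (fun k x => (-1) ^ k *
    (knot s k ^ q * ppart (x - knot s k) + - knot s (S k) ^ q * ppart (x - knot s (S k))))).
  intros k _.
  replace (h * (Rabs (knot s k) ^ q + Rabs (knot s (S k)) ^ q))
    with (Rabs ((-1) ^ k) * (Rabs (knot s k ^ q) * h + Rabs (- knot s (S k) ^ q) * h)).
  2:{ rewrite Rabs_pow_m1, Rabs_Ropp, !RPow_abs. ring. }
  apply vbound_scal.
  apply (vbound_plus 2 h (fun x => knot s k ^ q * ppart (x - knot s k))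
           (fun x => - knot s (S k) ^ q * ppart (x - knot s (S k))));
    apply vbound_scal; now apply vbound_ppart.
Qed.

Lemma vbound_tspl_up s q p n h V d : 0 < h ->
  vbound n h (tspl s q (S p)) V -> vbound (d + n) h (tspl s q (d + S p)) (h ^ d * V).
Proof.
  intros Hh H; induction d as [|d IH]; simpl; [now rewrite Rmult_1_l|].
  rewrite Rmult_assoc. apply (vbound_derive _ _ _ (tspl s q (d + S p))); try assumption.
  intros x. rewrite Nat.add_succ_r. apply derivable_tspl.
Qed.

(** Here [Q'] is no derivative but an increasing function whose increments dominate those of [Q]. Up
    to sign, the functional of Q(max(x,u)) - Q(u) is the integral of the alternating sign against dQ
    over u < x, so its variation in x is at most that of [Q'] on [-1,1]. *)
Lemma altf_max_dominated s (Q Q' : R -> R) : (0 < s)%nat ->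
  (forall v w, v <= w -> Rabs (Q w - Q v) <= Q' w - Q' v) ->
  forall a b, a <= b ->
  Rabs (altf s (fun u => Q (Rmax b u) - Q u) - altf s (fun u => Q (Rmax a u) - Q u))
  <= (Q' (Rmax b (-1)) - Q' (Rmax b 1)) - (Q' (Rmax a (-1)) - Q' (Rmax a 1)).
Proof.
  intros Hs HQ a b Hab.
  (* The increment over [p,q] that survives the maximum with x is the one over the part of [p,q]
     above x. *)
  assert (cl : forall (P : R -> R) p q x, p <= q ->
            P (Rmax x q) - P (Rmax x p) = P q - P (Rmax p (Rmin x q))).
  { intros P p q x Hpq. destruct (Rle_dec x q).
    - rewrite (Rmax_right x q), Rmin_left, (Rmax_comm x p) by lra. reflexivity.
    - rewrite (Rmax_left x q), Rmin_right, (Rmax_left x p), Rmax_right by lra. ring. }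
  rewrite <- altf_minus. unfold altf.
  eapply Rle_trans; [apply rsum_Rabs|].
  apply Rle_trans with (rsum (fun k =>
     (Q' (Rmax b (knot s (S k))) - Q' (Rmax a (knot s (S k))))
     - (Q' (Rmax b (knot s k)) - Q' (Rmax a (knot s k)))) s).
  - apply rsum_le; intros k Hk. rewrite Rabs_mult, Rabs_pow_m1, Rmult_1_l.
    assert (Hp : knot s (S k) <= knot s k) by (apply knot_le; lia).
    set (p := knot s (S k)) in *. set (q := knot s k) in *.
    replace (Q (Rmax b q) - Q q - (Q (Rmax a q) - Q q)
             - (Q (Rmax b p) - Q p - (Q (Rmax a p) - Q p)))
      with ((Q (Rmax b q) - Q (Rmax b p)) - (Q (Rmax a q) - Q (Rmax a p))) by ring.
    replace (Q' (Rmax b p) - Q' (Rmax a p) - (Q' (Rmax b q) - Q' (Rmax a q)))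
      with ((Q' (Rmax a q) - Q' (Rmax a p)) - (Q' (Rmax b q) - Q' (Rmax b p))) by ring.
    rewrite !cl by assumption.
    replace (Q q - Q (Rmax p (Rmin b q)) - (Q q - Q (Rmax p (Rmin a q))))
      with (- (Q (Rmax p (Rmin b q)) - Q (Rmax p (Rmin a q)))) by ring.
    rewrite Rabs_Ropp. eapply Rle_trans; [apply HQ|lra].
    unfold Rmax, Rmin. repeat destruct (Rle_dec _ _); lra.
  - rewrite (rsum_telescope (fun k => Q' (Rmax b (knot s k)) - Q' (Rmax a (knot s k)))).
    rewrite knot_0, knot_last by assumption. lra.
Qed.

Lemma tspl_1_max s x : tspl s 0 1 x = altf s (fun u => Rmax x u - u).
Proof.
  unfold tspl. simpl (fact 1). simpl (INR 1). unfold Rdiv. rewrite Rinv_1, Rmult_1_r.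
  apply altf_ext; intros u. simpl. unfold ppart, Rmax.
  repeat destruct (Rle_dec _ _); lra.
Qed.

(** The spline has slope 1 or -1 on [-1,1] and is constant outside, so its variation is at most
    2. *)
Lemma vbound_tspl_0_1 s h : (0 < s)%nat -> 0 < h -> vbound 1 h (tspl s 0 1) 2.
Proof.
  intros Hs Hh. replace 2 with (0 - (-2)) by ring.
  apply (vbound_dominated h _ (fun x => Rmax x (-1) - Rmax x 1)); [assumption| |].
  - intros a b Hab. rewrite !tspl_1_max.
    apply (altf_max_dominated s (fun v => v) (fun v => v)); try assumption.
    intros v w Hvw. rewrite Rabs_right; lra.
  - intros x. unfold Rmax. repeat destruct (Rle_dec _ _); lra.
Qed.

(** * Bounds at the lowest degrees that exploit cancellation between knots *)

Definition tau (s : nat) : R := tan (PI / (2 * INR s)).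

Lemma tau_angle s : (2 <= s)%nat -> 0 < PI / (2 * INR s) < PI / 2.
Proof.
  intros Hs. assert (2 <= INR s) by (apply (le_INR 2); assumption).
  pose proof PI_RGT_0. split.
  - apply Rdiv_lt_0_compat; lra.
  - apply Rmult_lt_compat_l; [assumption|]. apply Rinv_lt_contravar; lra.
Qed.

Lemma tau_pos s : (2 <= s)%nat -> 0 < tau s.
Proof. intros Hs. apply tan_gt_0; now apply tau_angle. Qed.

(** This is cos a - cos b = tan((b-a)/2) (sin a + sin b). All knots have the same angular step pi/s,
    so the tangent is a common factor and alternating sums of the steps telescope. *)
Lemma knot_step s m : (2 <= s)%nat ->
  knot s m - knot s (S m)
  = tau s * (sin (INR m * PI / INR s) + sin (INR (S m) * PI / INR s)).
Proof.
  intros Hs. pose proof (tau_angle s Hs) as Ha.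
  assert (0 < INR s) by (apply lt_0_INR; lia).
  assert (Hc : 0 < cos (PI / (2 * INR s))) by (apply cos_gt_0; lra).
  unfold knot, tau, tan. set (al := PI / (2 * INR s)) in *.
  set (mu := INR m * PI / INR s + al).
  replace (INR m * PI / INR s) with (mu - al) by (unfold mu; ring).
  replace (INR (S m) * PI / INR s) with (mu + al)
    by (unfold mu, al; rewrite S_INR; field; lra).
  rewrite cos_minus, cos_plus, sin_minus, sin_plus. field. lra.
Qed.

Lemma knot_alt_sum s m : (2 <= s)%nat ->
  rsum (fun k => (-1) ^ k * (knot s k - knot s (S k))) m
  = - ((-1) ^ m * tau s * sin (INR m * PI / INR s)).
Proof.
  intros Hs; induction m as [|m IH].
  - simpl. unfold Rdiv. rewrite !Rmult_0_l, sin_0. ring.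
  - cbn [rsum]. rewrite IH, knot_step by assumption. cbn [pow]. ring.
Qed.

Lemma knot_interval s x : (0 < s)%nat -> -1 <= x <= 1 ->
  exists m, (m < s)%nat /\ knot s (S m) <= x <= knot s m.
Proof.
  intros Hs [H1 H2].
  assert (H : forall n, (S n <= s)%nat -> knot s (S n) <= x ->
            exists m, (m < s)%nat /\ knot s (S m) <= x <= knot s m).
  { induction n as [|n IH]; intros Hn Hx.
    - exists 0%nat. rewrite knot_0. repeat split; (lia || assumption).
    - destruct (Rle_dec x (knot s (S n))) as [Hle|Hgt].
      + exists (S n). repeat split; (lia || assumption).
      + apply IH; [lia|lra]. }
  apply (H (s - 1)%nat); [lia|].
  replace (S (s - 1)) with s by lia. rewrite knot_last by assumption. assumption.
Qed.

(* On the interval between the knots of index m+1 and m the spline is affine and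
   takes the values (-1)^m tau sin(theta_(m+1)) and -(-1)^m tau sin(theta_m) at the ends. *)
Lemma tspl_1_bound s x : (2 <= s)%nat -> Rabs (tspl s 0 1 x) <= tau s.
Proof.
  intros Hs. pose proof (tau_pos s Hs) as Ht.
  destruct (Rle_dec x (-1)) as [Hx|Hx]; [rewrite tspl_left, Rabs_R0 by assumption; lra|].
  destruct (Rle_dec 1 x) as [Hx'|Hx'];
    [rewrite tspl_right_0, Rabs_R0 by (assumption || lia); lra|].
  destruct (knot_interval s x) as [m [Hm [Hl Hr]]]; [lia|lra|].
  (* The alternating sum splits at x: indices below m contribute zero, index m a partial interval,
     later indices full increments of the knots. *)
  assert (E : forall d, (m + S d <= s)%nat ->
     rsum (fun k => (-1) ^ k * ((Rmax x (knot s k) - knot s k)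
                      - (Rmax x (knot s (S k)) - knot s (S k)))) (m + S d)
     = - (-1) ^ m * (x - knot s (S m))
       - (rsum (fun k => (-1) ^ k * (knot s k - knot s (S k))) (m + S d)
          - rsum (fun k => (-1) ^ k * (knot s k - knot s (S k))) (S m))).
  { induction d as [|d IH]; intros Hd.
    - replace (m + 1)%nat with (S m) by lia. cbn [rsum].
      rewrite (rsum_ext _ (fun _ => 0)).
      + rewrite rsum_const. rewrite (Rmax_right x (knot s m)), (Rmax_left x) by assumption. ring.
      + intros k Hk.
        assert (knot s m <= knot s (S k)) by (apply knot_antitone; lia).
        assert (knot s m <= knot s k) by (apply knot_antitone; lia).
        rewrite !Rmax_right by lra. ring.
    - replace (m + S (S d))%nat with (S (m + S d)) by lia.
      cbn [rsum] in *. rewrite IH by lia.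
      assert (knot s (m + S d) <= knot s (S m)) by (apply knot_antitone; lia).
      assert (knot s (S (m + S d)) <= knot s (S m)) by (apply knot_antitone; lia).
      rewrite !Rmax_left by lra. ring. }
  rewrite tspl_1_max. unfold altf.
  specialize (E (s - S m)%nat). replace (m + S (s - S m))%nat with s in E by lia.
  rewrite E by lia. rewrite !knot_alt_sum by assumption.
  replace (INR s * PI / INR s) with PI by (field; apply not_0_INR; lia). rewrite sin_PI.
  pose proof (knot_step s m Hs) as Hst.
  assert (S1 : 0 <= sin (INR m * PI / INR s) <= 1).
  { destruct (knot_angle s m); [lia|lia|]. split; [now apply sin_ge_0|apply SIN_bound]. }
  assert (S2 : 0 <= sin (INR (S m) * PI / INR s) <= 1).
  { destruct (knot_angle s (S m)); [lia|lia|]. split; [now apply sin_ge_0|apply SIN_bound]. }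
  set (s1 := sin (INR m * PI / INR s)) in *. set (s2 := sin (INR (S m) * PI / INR s)) in *.
  replace (- (-1) ^ m * (x - knot s (S m))
     - (- ((-1) ^ s * tau s * 0) - - ((-1) ^ S m * tau s * s2)))
    with ((-1) ^ m * (tau s * s2 - (x - knot s (S m)))) by (cbn [pow]; ring).
  rewrite Rabs_mult, Rabs_pow_m1, Rmult_1_l. apply Rabs_le. nra.
Qed.

(** Projection onto the support: a Lipschitz bound in [clamp x] instead of x gives a finite total
    variation. *)
Definition clamp (x : R) : R := Rmax (-1) (Rmin x 1).

Lemma clamp_bound x : -1 <= clamp x <= 1.
Proof. unfold clamp, Rmax, Rmin; repeat destruct (Rle_dec _ _); lra. Qed.

Lemma clamp_monotone a b : a <= b -> clamp a <= clamp b.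
Proof. unfold clamp, Rmax, Rmin; repeat destruct (Rle_dec _ _); lra. Qed.

Lemma tspl_clamp s q p x : (q + S p < s)%nat -> tspl s q (S p) (clamp x) = tspl s q (S p) x.
Proof.
  intros H. unfold clamp, Rmax, Rmin. destruct (Rle_dec x 1).
  - destruct (Rle_dec (-1) x); [reflexivity|]. rewrite !tspl_left by lra; reflexivity.
  - destruct (Rle_dec (-1) 1); [|lra]. rewrite !tspl_right_0 by (assumption || lra). reflexivity.
Qed.

Lemma tspl_2_dominated s a b : (3 <= s)%nat -> a <= b ->
  Rabs (tspl s 0 2 b - tspl s 0 2 a) <= tau s * clamp b - tau s * clamp a.
Proof.
  intros Hs Hab. rewrite <- (tspl_clamp s 0 1 b), <- (tspl_clamp s 0 1 a) by lia.
  pose proof (clamp_monotone a b Hab) as [Hlt|Heq].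
  - destruct (MVT_cor2 (tspl s 0 2) (tspl s 0 1) (clamp a) (clamp b) Hlt) as [xi [Hxi _]].
    { intros; apply derivable_tspl. }
    rewrite Hxi, Rabs_mult, (Rabs_right (clamp b - clamp a)) by lra.
    pose proof (tspl_1_bound s xi ltac:(lia)). nra.
  - rewrite Heq, !Rminus_diag, Rabs_R0. lra.
Qed.

Lemma vbound_tspl_0_2 s h : (3 <= s)%nat -> 0 < h -> vbound 1 h (tspl s 0 2) (2 * tau s).
Proof.
  intros Hs Hh. pose proof (tau_pos s ltac:(lia)).
  replace (2 * tau s) with (tau s - - tau s) by ring.
  apply (vbound_dominated h _ (fun x => tau s * clamp x)); [assumption| |].
  - intros; now apply tspl_2_dominated.
  - intros x. pose proof (clamp_bound x). nra.
Qed.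

(** For u <= x one has u (x-u) = (x^2 - u^2)/2 - (x-u)^2/2. The first part falls under
    [altf_max_dominated], the second is a spline that is already controlled. *)
Lemma tspl_1_1_max s x :
  tspl s 1 1 x = altf s (fun u => Rmax x u * Rmax x u / 2 - u * u / 2) - tspl s 0 2 x.
Proof.
  pose proof (tspl_mul_x s 0 0 x) as H. simpl (INR 2) in H.
  enough (x * tspl s 0 1 x - tspl s 0 2 x
          = altf s (fun u => Rmax x u * Rmax x u / 2 - u * u / 2)) by lra.
  unfold tspl. simpl (fact _). simpl (INR _). unfold Rdiv. rewrite Rinv_1, Rmult_1_r.
  rewrite (Rmult_comm (altf s (fun u => u ^ 0 * ppart (x - u) ^ 2))).
  rewrite <- !altf_scal, <- altf_minus. apply altf_ext; intros u. simpl.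
  destruct (Rle_dec u x).
  - rewrite ppart_of_nonneg, Rmax_left by lra. field.
  - rewrite ppart_of_nonpos, Rmax_right by lra. field.
Qed.

Lemma vbound_tspl_1_1 s h : (3 <= s)%nat -> 0 < h -> vbound 1 h (tspl s 1 1) (1 + 2 * tau s).
Proof.
  intros Hs Hh. pose proof (tau_pos s ltac:(lia)).
  (* The function v |v| / 2 is the antiderivative of |v|, so the first part contributes the integral
     of |v| over [-1,1], which is 1; the clamped part contributes 2 tau. *)
  set (Phi := fun x => (Rmax x (-1) * Rabs (Rmax x (-1)) / 2 - Rmax x 1 * Rabs (Rmax x 1) / 2)
                       + tau s * clamp x).
  replace (1 + 2 * tau s) with (tau s - (- 1 - tau s)) by ring.
  apply (vbound_dominated h _ Phi); [assumption| |].
  - intros a b Hab. rewrite !tspl_1_1_max. unfold Phi.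
    pose proof (tspl_2_dominated s a b Hs Hab) as H2.
    pose proof (altf_max_dominated s (fun v => v * v / 2) (fun v => v * Rabs v / 2)
                  ltac:(lia)) as H1.
    assert (H1' : forall v w, v <= w ->
              Rabs (w * w / 2 - v * v / 2) <= w * Rabs w / 2 - v * Rabs v / 2).
    { intros v w Hvw. apply Rabs_le. unfold Rabs. destruct (Rcase_abs w), (Rcase_abs v); nra. }
    specialize (H1 H1' a b Hab). cbv beta in H1.
    match goal with |- Rabs (?A - ?B - (?C - ?D)) <= _ =>
      replace (A - B - (C - D)) with ((A - C) + - (B - D)) by ring end.
    eapply Rle_trans; [apply Rabs_triang|]. rewrite Rabs_Ropp. lra.
  - intros x. pose proof (clamp_bound x) as Hc. unfold Phi.
    assert (-1 <= Rmax x (-1) * Rabs (Rmax x (-1)) / 2 - Rmax x 1 * Rabs (Rmax x 1) / 2 <= 0).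
    { unfold Rmax. repeat destruct (Rle_dec _ _); unfold Rabs; repeat destruct (Rcase_abs _); nra. }
    nra.
Qed.

(** The squared cosines have mean 1/2 because the cosines of the doubled angles sum to zero over the
    knots; this halves the trivial bound 2s. *)
Lemma knot_sum_sqr s : (2 <= s)%nat ->
  rsum (fun k => Rabs (knot s k) ^ 2 + Rabs (knot s (S k)) ^ 2) s = INR s.
Proof.
  intros Hs. assert (Hs0 : 2 <= INR s) by (apply (le_INR 2); assumption).
  pose proof PI_RGT_0.
  set (b := 2 * PI / INR s).
  assert (Z : rsum (fun k => cos (INR k * b) + cos (INR (S k) * b)) s = 0).
  { assert (Hsin : 0 < sin (b / 2)).
    { unfold b. replace (2 * PI / INR s / 2) with (PI / INR s) by (field; lra).
      apply sin_gt_0; [apply Rdiv_lt_0_compat; lra|].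
      apply Rmult_lt_reg_r with (INR s); [lra|].
      unfold Rdiv. rewrite Rmult_assoc, Rinv_l by lra. nra. }
    apply Rmult_eq_reg_r with (sin (b / 2)); [|lra]. rewrite sum_cos_pairs.
    replace (INR s * b) with (INR 2 * PI) by (unfold b; simpl; field; lra).
    rewrite sin_INR_PI. ring. }
  rewrite (rsum_ext _ (fun k => 1 + / 2 * (cos (INR k * b) + cos (INR (S k) * b)))).
  - rewrite rsum_plus, rsum_scal, Z, rsum_const. ring.
  - assert (C : forall k, Rabs (knot s k) ^ 2 = / 2 + / 2 * cos (INR k * b)).
    { intros k. rewrite pow2_abs. unfold knot, b.
      replace (INR k * (2 * PI / INR s)) with (2 * (INR k * PI / INR s)) by (field; lra).
      rewrite cos_2a_cos. field. }
    intros k _. rewrite !C. lra.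
Qed.

Lemma knot_sum_le s q :
  rsum (fun k => Rabs (knot s k) ^ q + Rabs (knot s (S k)) ^ q) s <= 2 * INR s.
Proof.
  rewrite Rmult_comm, <- rsum_const. apply rsum_le; intros k _.
  assert (B : forall k, Rabs (knot s k) ^ q <= 1).
  { intros j. rewrite <- (pow1 q). apply pow_incr. split; [apply Rabs_pos|].
    apply Rabs_le. apply knot_bound. }
  pose proof (B k). pose proof (B (S k)). lra.
Qed.

Lemma vbound_tspl_top s q h V : (2 <= s)%nat -> 0 < h ->
  rsum (fun k => Rabs (knot s k) ^ q + Rabs (knot s (S k)) ^ q) s <= V ->
  vbound s h (tspl s q (s - 1)) (h ^ (s - 1) * V).
Proof.
  intros Hs Hh HV.
  pose proof (vbound_tspl_up s q 0 2 h _ (s - 2) Hh (vbound_tspl_1 s q h Hh)) as H.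
  replace (s - 2 + 2)%nat with s in H by lia. replace (s - 2 + 1)%nat with (s - 1)%nat in H by lia.
  refine (vbound_weaken _ _ _ _ _ _ H).
  rewrite <- Rmult_assoc. replace (h ^ (s - 2) * h) with (h ^ (s - 1)).
  - apply Rmult_le_compat_l; [apply pow_le; lra|assumption].
  - replace (s - 1)%nat with (S (s - 2)) by lia. simpl. ring.
Qed.

Lemma vbound_spline s h : (2 <= s)%nat -> 0 < h ->
  vbound s h (tspl s 0 (s - 1)) (h ^ (s - 1) * (2 * INR s)).
Proof. intros; apply vbound_tspl_top; [assumption|assumption|apply knot_sum_le]. Qed.

Lemma vbound_x_spline s h : (2 <= s)%nat -> 0 < h ->
  vbound s h (fun x => x * tspl s 0 (s - 1) x) (h ^ (s - 1) * (4 * INR s)).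
Proof.
  intros Hs Hh.
  apply (vbound_ext _ _ (fun x => INR s * tspl s 0 s x + tspl s 1 (s - 1) x)).
  { intros x. destruct s as [|[|n]]; try lia. replace (S (S n) - 1)%nat with (S n) by lia.
    now rewrite tspl_mul_x. }
  replace (h ^ (s - 1) * (4 * INR s))
    with (Rabs (INR s) * (h ^ (s - 1) * 2) + h ^ (s - 1) * (2 * INR s)).
  2:{ rewrite Rabs_right by (apply Rle_ge, pos_INR). ring. }
  apply (vbound_plus s h (fun x => INR s * tspl s 0 s x)).
  - apply vbound_scal.
    pose proof (vbound_tspl_up s 0 0 1 h _ (s - 1) Hh (vbound_tspl_0_1 s h ltac:(lia) Hh)) as H.
    now replace (s - 1 + 1)%nat with s in H by lia.
  - apply vbound_tspl_top; [assumption|assumption|apply knot_sum_le].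
Qed.

(** Two applications of [tspl_mul_x] give x^2 g as a sum of three splines, with factors s(s+1), 2s
    and 1. Their variations come from the height of the affine spline, from [vbound_tspl_1_1], and
    from the kinks weighted by squared knots. *)
Lemma vbound_xx_spline s h : (3 <= s)%nat -> 0 < h ->
  vbound s h (fun x => x * (x * tspl s 0 (s - 1) x))
    (h ^ (s - 1) * (2 * INR s * (INR s + 1) * tau s + 2 * INR s * (1 + 2 * tau s) + INR s)).
Proof.
  intros Hs Hh. pose proof (tau_pos s ltac:(lia)) as Ht. pose proof (pos_INR s) as Hp.
  apply (vbound_ext _ _ (fun x => INR s * (INR s + 1) * tspl s 0 (S s) x
            + (2 * INR s * tspl s 1 s x + tspl s 2 (s - 1) x))).
  { intros x. destruct s as [|[|n]]; try lia. replace (S (S n) - 1)%nat with (S n) by lia.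
    pose proof (tspl_mul_x (S (S n)) 0 n x) as E1.
    pose proof (tspl_mul_x (S (S n)) 0 (S n) x) as E2.
    pose proof (tspl_mul_x (S (S n)) 1 n x) as E3.
    rewrite E1, (Rmult_plus_distr_l x), E3.
    replace (x * (INR (S (S n)) * tspl (S (S n)) 0 (S (S n)) x))
      with (INR (S (S n)) * (x * tspl (S (S n)) 0 (S (S n)) x)) by ring.
    rewrite E2. rewrite (S_INR (S (S n))). ring. }
  replace (h ^ (s - 1) * (2 * INR s * (INR s + 1) * tau s + 2 * INR s * (1 + 2 * tau s) + INR s))
    with (Rabs (INR s * (INR s + 1)) * (h ^ (s - 1) * (2 * tau s))
          + (Rabs (2 * INR s) * (h ^ (s - 1) * (1 + 2 * tau s)) + h ^ (s - 1) * INR s)).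
  2:{ rewrite !Rabs_right by nra. ring. }
  apply (vbound_plus s h (fun x => INR s * (INR s + 1) * tspl s 0 (S s) x)
           (fun x => 2 * INR s * tspl s 1 s x + tspl s 2 (s - 1) x)).
  - apply vbound_scal.
    pose proof (vbound_tspl_up s 0 1 1 h _ (s - 1) Hh (vbound_tspl_0_2 s h Hs Hh)) as H.
    replace (s - 1 + 1)%nat with s in H by lia. now replace (s - 1 + 2)%nat with (S s) in H by lia.
  - apply (vbound_plus s h (fun x => 2 * INR s * tspl s 1 s x)).
    + apply vbound_scal.
      pose proof (vbound_tspl_up s 1 0 1 h _ (s - 1) Hh (vbound_tspl_1_1 s h Hs Hh)) as H.
      now replace (s - 1 + 1)%nat with s in H by lia.
    + apply vbound_tspl_top; [lia|assumption|]. right. apply knot_sum_sqr. lia.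
Qed.


(** * Trigonometric sums of samples *)

(** The free phase keeps sines, derivatives and every step of summation by parts within the same
    family of cosine sums. *)
Definition trigsum (f : R -> R) (c : R) (J : nat) (h th ph : R) : R :=
  rsum (fun j => f (c + INR j * h) * cos (INR j * th + ph)) (S J).

Definition supported (f : R -> R) (a b : R) : Prop :=
  forall x, x <= a \/ b <= x -> f x = 0.

Lemma supported_diff f c J h : 0 < h -> supported f c (c + INR J * h) ->
  supported (diff h f) (c - h) (c - h + INR (S J) * h).
Proof.
  intros Hh H x Hx. rewrite S_INR in Hx. unfold diff. rewrite !H; [ring| |]; lra.
Qed.

(** Here 2 sin(th/2) cos a = sin(a + th/2) - sin(a - th/2), and no boundary terms arise because the
    samples just outside the window vanish. *)
Lemma trigsum_by_parts f c J h th ph : 0 < h -> supported f c (c + INR J * h) ->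
  2 * sin (th / 2) * trigsum f c J h th ph
  = trigsum (diff h f) (c - h) (S J) h th (ph - th / 2 + PI / 2).
Proof.
  intros Hh Hf. unfold trigsum.
  rewrite (rsum_ext (fun j => diff h f (c - h + INR j * h) * _)
     (fun j => f (c - h + INR j * h) * sin (INR j * th + ph - th / 2)
               - f (c + INR j * h) * sin (INR j * th + ph - th / 2))).
  2:{ intros j _. unfold diff. replace (c - h + INR j * h + h) with (c + INR j * h) by ring.
      replace (INR j * th + (ph - th / 2 + PI / 2)) with (PI / 2 + (INR j * th + ph - th / 2))
        by ring.
      rewrite cos_plus, cos_PI2, sin_PI2. ring. }
  rewrite rsum_minus, (rsum_S_l (fun j => f (c - h + INR j * h) * _)).
  rewrite (rsum_S_r (fun j => f (c + INR j * h) * sin (INR j * th + ph - th / 2))).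
  rewrite (Hf (c - h + INR 0 * h)) by (simpl; lra).
  rewrite (Hf (c + INR (S J) * h)) by (rewrite S_INR; lra).
  rewrite !Rmult_0_l, Rplus_0_l, Rplus_0_r, <- rsum_scal, <- rsum_minus.
  apply rsum_ext; intros j _. rewrite S_INR.
  replace (c - h + (INR j + 1) * h) with (c + INR j * h) by ring.
  replace ((INR j + 1) * th + ph - th / 2) with (INR j * th + ph + th / 2) by field.
  replace (INR j * th + ph - th / 2) with ((INR j * th + ph) - th / 2) by ring.
  rewrite sin_plus, sin_minus. ring.
Qed.

Lemma trigsum_by_parts_iter f h th n : 0 < h -> forall c J ph,
  supported f c (c + INR J * h) ->
  exists c' J' ph',
    supported (diffn n h f) c' (c' + INR J' * h) /\
    (2 * sin (th / 2)) ^ n * trigsum f c J h th ph = trigsum (diffn n h f) c' J' h th ph'.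
Proof.
  intros Hh c J ph Hf. induction n as [|n (c' & J' & ph' & Hs & E)].
  - exists c, J, ph. split; [assumption|simpl; ring].
  - exists (c' - h), (S J'), (ph' - th / 2 + PI / 2). split.
    + now apply supported_diff.
    + simpl pow. rewrite Rmult_assoc, E. now apply trigsum_by_parts.
Qed.

Lemma trigsum_vbound f n h th c J ph V : 0 < h -> supported f c (c + INR J * h) ->
  vbound n h f V -> Rabs (2 * sin (th / 2)) ^ n * Rabs (trigsum f c J h th ph) <= V.
Proof.
  intros Hh Hf HV.
  destruct (trigsum_by_parts_iter f h th n Hh c J ph Hf) as (c' & J' & ph' & _ & E).
  rewrite RPow_abs, <- Rabs_mult, E. unfold trigsum.
  eapply Rle_trans; [apply rsum_Rabs|]. eapply Rle_trans; [|apply (HV c' (S J'))].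
  apply rsum_le; intros j _. rewrite Rabs_mult.
  rewrite <- (Rmult_1_r (Rabs (diffn _ _ _ _))) at 2.
  apply Rmult_le_compat_l; [apply Rabs_pos|]. apply Rabs_le, COS_bound.
Qed.

(* Averaging over the two square roots of e^(i th) kills the odd samples: iterated,
   this is a finite form of Poisson summation. *)
Lemma trigsum_halve f c J h th ph :
  trigsum f c J h th ph
  = / 2 * (trigsum f c (2 * J) (h / 2) (th / 2) ph
           + trigsum f c (2 * J) (h / 2) (th / 2 + PI) ph).
Proof.
  unfold trigsum. rewrite <- rsum_plus, <- rsum_scal.
  set (F := fun j => / 2 * (f (c + INR j * (h / 2)) * cos (INR j * (th / 2) + ph)
             + f (c + INR j * (h / 2)) * cos (INR j * (th / 2 + PI) + ph))).
  assert (HF : forall j, F j = / 2 * (1 + (-1) ^ j)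
             * (f (c + INR j * (h / 2)) * cos (INR j * (th / 2) + ph))).
  { intros j. unfold F.
    replace (INR j * (th / 2 + PI) + ph) with (INR j * (th / 2) + ph + INR j * PI) by ring.
    rewrite cos_plus_INR_PI. ring. }
  assert (Heven : forall j, F (2 * j)%nat = f (c + INR j * h) * cos (INR j * th + ph)).
  { intros j. rewrite HF, pow_1_even, mult_INR. simpl (INR 2).
    replace ((1 + 1) * INR j * (h / 2)) with (INR j * h) by field.
    replace ((1 + 1) * INR j * (th / 2)) with (INR j * th) by field. field. }
  assert (Hodd : forall j, F (S (2 * j)) = 0).
  { intros j. rewrite HF, pow_1_odd. ring. }
  induction J as [|J IH].
  - change (2 * 0)%nat with 0%nat. cbn [rsum]. rewrite <- Heven. reflexivity.
  - replace (2 * S J)%nat with (S (S (2 * J))) by lia.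
    change (rsum F (S (S (S (2 * J)))))
      with (rsum F (S (2 * J)) + F (S (2 * J)) + F (S (S (2 * J)))).
    rewrite <- IH, Hodd. replace (S (S (2 * J))) with (2 * S J)%nat by lia.
    rewrite Heven. cbn [rsum]. ring.
Qed.

Lemma trigsum_leaves f c J h th ph n :
  trigsum f c J h th ph
  = / 2 ^ n * rsum (fun m => trigsum f c (2 ^ n * J) (h / 2 ^ n)
                               ((th + 2 * PI * INR m) / 2 ^ n) ph) (2 ^ n).
Proof.
  assert (P : forall n, (2:R) ^ n <> 0) by (intros; apply pow_nonzero; lra).
  induction n as [|n IH].
  - simpl. rewrite Nat.add_0_r. replace (h / 1) with h by field.
    replace ((th + 2 * PI * 0) / 1) with th by field. field.
  - rewrite IH at 1.
    replace (2 ^ S n)%nat with (2 ^ n + 2 ^ n)%nat by (simpl; lia).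
    rewrite rsum_app, <- rsum_plus.
    rewrite (rsum_ext _ (fun m => / 2 *
       (trigsum f c ((2 ^ n + 2 ^ n) * J) (h / 2 ^ S n) ((th + 2 * PI * INR m) / 2 ^ S n) ph
        + trigsum f c ((2 ^ n + 2 ^ n) * J) (h / 2 ^ S n)
            ((th + 2 * PI * INR (2 ^ n + m)) / 2 ^ S n) ph))).
    + rewrite rsum_scal. simpl pow. field. apply P.
    + intros m _. rewrite trigsum_halve.
      replace (2 * (2 ^ n * J))%nat with ((2 ^ n + 2 ^ n) * J)%nat by lia.
      replace (h / 2 ^ n / 2) with (h / 2 ^ S n) by (simpl; field; apply P).
      replace ((th + 2 * PI * INR m) / 2 ^ n / 2) with ((th + 2 * PI * INR m) / 2 ^ S n)
        by (simpl; field; apply P).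
      replace ((th + 2 * PI * INR m) / 2 ^ S n + PI)
        with ((th + 2 * PI * INR (2 ^ n + m)) / 2 ^ S n); [reflexivity|].
      rewrite plus_INR, pow_INR. simpl (INR 2). replace (1 + 1) with 2 by ring.
      simpl; field. apply P.
Qed.

(** * Weights of the refined frequencies and their limit *)

(** For fixed m this tends to (th + 2 pi m)^(-2) as n grows; the last indices correspond to negative
    m. *)
Definition leafw (n : nat) (th : R) (m : nat) : R :=
  / (2 ^ n * (2 * sin ((th + 2 * PI * INR m) / 2 ^ n / 2))) ^ 2.

Lemma leaf_angle n th m : 0 < th < 2 * PI -> (m < 2 ^ n)%nat ->
  0 < (th + 2 * PI * INR m) / 2 ^ n / 2 < PI.
Proof.
  intros Ht Hm. assert (P : 0 < 2 ^ n) by (apply pow_lt; lra).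
  pose proof (pos_INR m). pose proof PI_RGT_0.
  assert (Hm' : INR m + 1 <= 2 ^ n).
  { rewrite <- S_INR. replace (2 ^ n) with (INR (2 ^ n)).
    - apply le_INR; lia.
    - rewrite pow_INR. reflexivity. }
  split.
  - apply Rmult_lt_0_compat; [apply Rdiv_lt_0_compat; nra|lra].
  - apply Rmult_lt_reg_r with (2 ^ n * 2); [lra|].
    replace ((th + 2 * PI * INR m) / 2 ^ n / 2 * (2 ^ n * 2)) with (th + 2 * PI * INR m)
      by (field; lra).
    nra.
Qed.

(** One refinement replaces 4/sin^2 psi by 1/sin^2(psi/2) + 1/cos^2(psi/2), which is equal to it;
    the leaves m and 2^n + m supply the two terms. *)
Lemma leafw_sum n th : 0 < th < 2 * PI ->
  rsum (leafw n th) (2 ^ n) = / (2 * sin (th / 2)) ^ 2.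
Proof.
  intros Ht. induction n as [|n IH].
  - simpl. unfold leafw. simpl INR. rewrite Rmult_0_r, Rplus_0_r.
    replace (th / 2 ^ 0 / 2) with (th / 2) by (simpl; field).
    rewrite Rplus_0_l. f_equal. simpl. ring.
  - rewrite <- IH. replace (2 ^ S n)%nat with (2 ^ n + 2 ^ n)%nat by (simpl; lia).
    rewrite rsum_app, <- rsum_plus. apply rsum_ext; intros m Hm. unfold leafw.
    assert (P : 0 < 2 ^ n) by (apply pow_lt; lra).
    pose proof (leaf_angle n th m Ht Hm) as Ha.
    set (psi := (th + 2 * PI * INR m) / 2 ^ n / 2) in *.
    replace ((th + 2 * PI * INR m) / 2 ^ S n / 2) with (psi / 2)
      by (unfold psi; simpl; field; lra).
    replace ((th + 2 * PI * INR (2 ^ n + m)) / 2 ^ S n / 2) with (PI / 2 + psi / 2).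
    2:{ unfold psi. rewrite plus_INR, pow_INR. simpl (INR 2). replace (1 + 1) with 2 by ring.
        simpl; field; lra. }
    rewrite sin_plus, sin_PI2, cos_PI2.
    assert (S1 : 0 < sin (psi / 2)) by (apply sin_gt_0; lra).
    assert (S2 : 0 < cos (psi / 2)) by (apply cos_gt_0; lra).
    assert (Esin : sin psi = 2 * sin (psi / 2) * cos (psi / 2))
      by (rewrite <- sin_2a; f_equal; field).
    rewrite Esin.
    pose proof (sin2_cos2 (psi / 2)) as Q. unfold Rsqr in Q.
    simpl pow. set (a := sin (psi / 2)) in *. set (b := cos (psi / 2)) in *.
    transitivity (/ (2 ^ n * (2 * (2 * a * b)) * (2 ^ n * (2 * (2 * a * b)) * 1)) * (a * a + b * b)).
    + field. repeat split; nra.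
    + rewrite Q. ring.
Qed.

(** The step h/2^n contributes 2^(-n(2r-1)) and the averaging 2^(-n). Together they give the power
    2r of 2^n, which is exactly what the r-th power of the weight contains. *)
Lemma trigsum_leafw f c J h th ph n r V : 0 < h -> (1 <= r)%nat -> 0 < th < 2 * PI ->
  supported f c (c + INR J * h) ->
  (forall h, 0 < h -> vbound (2 * r) h f (h ^ (2 * r - 1) * V)) ->
  Rabs (trigsum f c J h th ph)
  <= h ^ (2 * r - 1) * V * rsum (fun m => leafw n th m ^ r) (2 ^ n).
Proof.
  intros Hh Hr Ht Hf HV. assert (P : 0 < 2 ^ n) by (apply pow_lt; lra).
  rewrite (trigsum_leaves f c J h th ph n), Rabs_mult.
  rewrite (Rabs_right (/ 2 ^ n)) by (apply Rle_ge; left; now apply Rinv_0_lt_compat).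
  rewrite <- rsum_scal.
  apply Rle_trans with (/ 2 ^ n * rsum (fun m => 2 ^ n * (h ^ (2 * r - 1) * V * leafw n th m ^ r)) (2 ^ n)).
  2:{ rewrite rsum_scal. right. field. lra. }
  apply Rmult_le_compat_l; [left; now apply Rinv_0_lt_compat|].
  eapply Rle_trans; [apply rsum_Rabs|]. apply rsum_le; intros m Hm.
  pose proof (leaf_angle n th m Ht Hm) as Ha. unfold leafw.
  set (psi := (th + 2 * PI * INR m) / 2 ^ n) in *.
  assert (Hs : 0 < sin (psi / 2)) by (apply sin_gt_0; lra).
  assert (Hh' : 0 < h / 2 ^ n) by now apply Rdiv_lt_0_compat.
  pose proof (trigsum_vbound f (2 * r) (h / 2 ^ n) psi c (2 ^ n * J) ph
                ((h / 2 ^ n) ^ (2 * r - 1) * V) Hh') as B.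
  rewrite (Rabs_right (2 * sin (psi / 2))) in B by lra.
  assert (Hp : 0 < (2 * sin (psi / 2)) ^ (2 * r)) by (apply pow_lt; lra).
  apply Rmult_le_reg_l with ((2 * sin (psi / 2)) ^ (2 * r)); [assumption|].
  eapply Rle_trans; [apply B|].
  - replace (c + INR (2 ^ n * J) * (h / 2 ^ n)) with (c + INR J * h); [assumption|].
    rewrite mult_INR, pow_INR. simpl (INR 2). replace (1 + 1) with 2 by ring. field. lra.
  - now apply HV.
  - right. set (x := 2 * sin (psi / 2)) in *.
    rewrite pow_inv, <- pow_mult, Rpow_mult_distr.
    unfold Rdiv. rewrite Rpow_mult_distr, pow_inv.
    assert (Q : 0 < (2 ^ n) ^ (2 * r - 1)) by (apply pow_lt; lra).
    replace ((2 ^ n) ^ (2 * r)) with (2 ^ n * (2 ^ n) ^ (2 * r - 1)).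
    + field. lra.
    + replace (2 * r)%nat with (S (2 * r - 1)) at 2 by lia. reflexivity.
Qed.

Lemma sin_ge_cubic x : 0 <= x <= PI -> x * (1 - x ^ 2 / 6) <= sin x.
Proof.
  intros H. destruct (sin_bound x 0) as [L _]; [lra|lra|].
  replace (sin_approx x (2 * 0 + 1)) with (x * (1 - x ^ 2 / 6)) in L; [exact L|].
  unfold sin_approx, sin_term. simpl. field.
Qed.

Lemma PI_lt_315 : PI < 315 / 100.
Proof.
  destruct (Rlt_dec PI (315 / 100)) as [H|H]; [assumption|exfalso].
  (* 0.525 is 3.15/6, and its sine already exceeds 1/2 = sin(pi/6). *)
  pose proof PI_4. assert (Hx : 0 <= 525 / 1000 <= PI) by lra.
  pose proof (sin_ge_cubic (525 / 1000) Hx) as B.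
  assert (sin (525 / 1000) <= sin (PI / 6)) by (apply sin_incr_1; lra).
  rewrite sin_PI6 in *. lra.
Qed.

Lemma sin_le_sin a b : 0 <= a -> a <= b -> b <= PI - a -> sin a <= sin b.
Proof.
  intros Ha Hab Hb. destruct (Rle_dec b (PI / 2)).
  - apply sin_incr_1; lra.
  - rewrite <- (sin_PI_x b). apply sin_incr_1; lra.
Qed.

(** The factor eta < 1 replaces the passage to the limit 2^n 2 sin(v/2^(n+1)) -> v;
    [le_of_pow_approx] removes it at the end. *)
Lemma scaled_sin_ge eta v : 0 < eta < 1 -> 0 < v ->
  exists n0, forall n, (n0 <= n)%nat -> eta * v <= 2 ^ n * (2 * sin (v / 2 ^ n / 2)).
Proof.
  intros He Hv. pose proof PI2_1.
  destruct (INR_unbounded (v + v ^ 2 / (1 - eta))) as [n0 Hn0]. exists n0. intros n Hn.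
  assert (Hnn : INR n0 <= 2 ^ n).
  { apply Rle_trans with (INR n); [now apply le_INR|].
    replace (2 ^ n) with (INR (2 ^ n)) by now rewrite pow_INR.
    apply le_INR. pose proof (Nat.pow_gt_lin_r 2 n). lia. }
  assert (HK0 : 1 <= 2 ^ n) by (apply pow_R1_Rle; lra).
  set (K := 2 ^ n) in *.
  assert (Hq : 0 < v ^ 2 / (1 - eta)) by (apply Rdiv_lt_0_compat; [apply pow_lt|]; lra).
  assert (HK1 : v < K) by lra. assert (HK2 : v ^ 2 / (1 - eta) < K) by lra.
  assert (HK3 : v ^ 2 < (1 - eta) * K).
  { apply Rmult_lt_compat_l with (r := 1 - eta) in HK2; [|lra].
    replace ((1 - eta) * (v ^ 2 / (1 - eta))) with (v ^ 2) in HK2 by (field; lra). lra. }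
  assert (Hx : 0 <= v / K / 2 <= PI).
  { split; [apply Rmult_le_pos; [left; apply Rdiv_lt_0_compat; lra|lra]|].
    apply Rmult_le_reg_r with (K * 2); [lra|].
    replace (v / K / 2 * (K * 2)) with v by (field; lra). nra. }
  pose proof (sin_ge_cubic _ Hx) as B.
  assert (C : K * (2 * (v / K / 2 * (1 - (v / K / 2) ^ 2 / 6))) = v * (1 - (v / K / 2) ^ 2 / 6))
    by (field; lra).
  assert (D : (v / K / 2) ^ 2 <= 1 - eta).
  { apply Rmult_le_reg_r with (4 * (K * K)); [nra|].
    replace ((v / K / 2) ^ 2 * (4 * (K * K))) with (v ^ 2) by (field; lra). nra. }
  assert (E : eta <= 1 - (v / K / 2) ^ 2 / 6) by lra.
  apply Rle_trans with (v * (1 - (v / K / 2) ^ 2 / 6)); [nra|].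
  rewrite <- C. apply Rmult_le_compat_l; lra.
Qed.

Lemma inv_sqr_pow_le (z : R) (y : R) (r : nat) : 0 < z -> z <= y ->
  (/ y ^ 2) ^ r <= / z ^ (2 * r).
Proof.
  intros Hz Hy. rewrite pow_inv, <- pow_mult. apply Rinv_le_contravar.
  - now apply pow_lt.
  - apply pow_incr; lra.
Qed.

(** The leaves 0 and 2^n - 1 are the frequencies th and th - 2 pi nearest to zero and are kept
    apart. In all others r - 1 factors are bounded by the weight at 2 pi + th, and the remaining
    first powers are summed by [leafw_sum]. *)
Lemma leafw_pow_sum eta th r : 0 < eta < 1 -> 0 < th <= PI -> (1 <= r)%nat ->
  exists n, rsum (fun m => leafw n th m ^ r) (2 ^ n)
    <= / (eta * th) ^ (2 * r) + / (eta * (2 * PI - th)) ^ (2 * r)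
       + / (eta * (2 * PI + th)) ^ (2 * (r - 1)) * / (2 * sin (th / 2)) ^ 2.
Proof.
  intros He Ht Hr.
  destruct (scaled_sin_ge eta th He ltac:(lra)) as [n1 H1].
  destruct (scaled_sin_ge eta (2 * PI - th) He ltac:(lra)) as [n2 H2].
  destruct (scaled_sin_ge eta (2 * PI + th) He ltac:(lra)) as [n3 H3].
  set (n := S (n1 + n2 + n3)). exists n.
  specialize (H1 n ltac:(unfold n; lia)). specialize (H2 n ltac:(unfold n; lia)).
  specialize (H3 n ltac:(unfold n; lia)).
  assert (P : 0 < 2 ^ n) by (apply pow_lt; lra).
  assert (EK : INR (2 ^ n) = 2 ^ n) by now rewrite pow_INR.
  assert (HM : exists M, (2 ^ n)%nat = S (S M)).
  { exists (2 ^ n - 2)%nat. assert (1 <= 2 ^ (n1 + n2 + n3))%nat.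
    { apply Nat.neq_0_lt_0, Nat.pow_nonzero; lia. }
    unfold n. simpl. lia. }
  destruct HM as [M HM].
  assert (HMR : INR M = 2 ^ n - 2) by (rewrite <- EK, HM, !S_INR; ring).
  assert (W0 : leafw n th 0 ^ r <= / (eta * th) ^ (2 * r)).
  { unfold leafw. simpl INR. rewrite Rmult_0_r, Rplus_0_r.
    apply inv_sqr_pow_le; [nra|assumption]. }
  assert (W1 : leafw n th (S M) ^ r <= / (eta * (2 * PI - th)) ^ (2 * r)).
  { unfold leafw. rewrite S_INR, HMR.
    replace ((th + 2 * PI * (2 ^ n - 2 + 1)) / 2 ^ n / 2) with (PI - (2 * PI - th) / 2 ^ n / 2)
      by (field; lra).
    rewrite sin_PI_x. apply inv_sqr_pow_le; [nra|assumption]. }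
  assert (Hmid : forall m, (m < M)%nat -> leafw n th (S m) ^ r
     <= / (eta * (2 * PI + th)) ^ (2 * (r - 1)) * leafw n th (S m)).
  { intros m Hm.
    assert (Hy : eta * (2 * PI + th) <= 2 ^ n * (2 * sin ((th + 2 * PI * INR (S m)) / 2 ^ n / 2))).
    { eapply Rle_trans; [exact H3|]. apply Rmult_le_compat_l; [lra|].
      apply Rmult_le_compat_l; [lra|].
      assert (Hm' : INR (S m) <= INR M) by (apply le_INR; lia).
      rewrite HMR in Hm'. rewrite S_INR in *. pose proof (pos_INR m).
      assert (Hdiv : forall a b, a <= b -> a / 2 ^ n / 2 <= b / 2 ^ n / 2).
      { intros a b Hab. unfold Rdiv. apply Rmult_le_compat_r; [lra|].
        apply Rmult_le_compat_r; [left; now apply Rinv_0_lt_compat|assumption]. }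
      apply sin_le_sin.
      - replace 0 with (0 / 2 ^ n / 2) by (field; lra). apply Hdiv. lra.
      - apply Hdiv. nra.
      - replace (PI - (2 * PI + th) / 2 ^ n / 2)
          with ((2 * PI * 2 ^ n - (2 * PI + th)) / 2 ^ n / 2) by (field; lra).
        apply Hdiv. nra. }
    assert (Hz : 0 < eta * (2 * PI + th)) by nra.
    replace r with (S (r - 1)) at 1 by lia. simpl pow at 1. rewrite Rmult_comm.
    apply Rmult_le_compat_r.
    - unfold leafw. left. apply Rinv_0_lt_compat, pow_lt. lra.
    - unfold leafw. now apply inv_sqr_pow_le. }
  pose proof (leafw_sum n th ltac:(lra)) as Hsum.
  assert (N0 : forall m, (m < 2 ^ n)%nat -> 0 <= leafw n th m).
  { intros m Hm. pose proof (leaf_angle n th m ltac:(lra) Hm) as Ha. unfold leafw.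
    left. apply Rinv_0_lt_compat, pow_lt, Rmult_lt_0_compat; [assumption|].
    apply Rmult_lt_0_compat; [lra|]. apply sin_gt_0; lra. }
  pose proof (N0 0%nat ltac:(lia)) as N1. pose proof (N0 (S M) ltac:(lia)) as N2.
  rewrite HM in *. rewrite rsum_S_r, rsum_S_l in Hsum |- *.
  set (b := / (eta * (2 * PI + th)) ^ (2 * (r - 1))) in *.
  assert (Hb : 0 <= b).
  { left. apply Rinv_0_lt_compat, pow_lt. nra. }
  assert (Hm : rsum (fun m => leafw n th (S m) ^ r) M
               <= b * rsum (fun m => leafw n th (S m)) M).
  { rewrite <- rsum_scal. apply rsum_le. exact Hmid. }
  assert (b * rsum (fun m => leafw n th (S m)) M <= b * / (2 * sin (th / 2)) ^ 2)
    by (apply Rmult_le_compat_l; lra).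
  lra.
Qed.

Lemma Bernoulli_sub d n : 0 <= d <= 1 -> 1 - INR n * d <= (1 - d) ^ n.
Proof.
  intros Hd. induction n as [|n IH]; [simpl; lra|].
  rewrite S_INR. simpl. pose proof (pos_INR n).
  assert ((1 - d) * (1 - INR n * d) <= (1 - d) * (1 - d) ^ n)
    by (apply Rmult_le_compat_l; lra).
  nra.
Qed.

Lemma le_of_pow_approx X Y n : 0 <= X ->
  (forall eta, 0 < eta < 1 -> eta ^ n * X <= Y) -> X <= Y.
Proof.
  intros HX H. destruct (Rle_dec X Y) as [Hle|Hgt]; [assumption|exfalso].
  assert (HY : 0 <= Y).
  { eapply Rle_trans; [|apply (H (/ 2)); lra]. apply Rmult_le_pos; [apply pow_le; lra|assumption]. }
  pose proof (pos_INR n) as Hn.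
  (* With this d the Bernoulli loss n d X is below (X - Y)/2, so (1 - d)^n X would still exceed
     Y. *)
  set (d := (X - Y) / (2 * (INR n + 1) * X)).
  assert (Hden : 0 < 2 * (INR n + 1) * X) by (apply Rmult_lt_0_compat; lra).
  assert (Hd : 0 < d) by (apply Rdiv_lt_0_compat; lra).
  assert (Hd2 : d * (2 * (INR n + 1) * X) = X - Y) by (unfold d; field; lra).
  assert (Hd1 : d < 1).
  { apply Rmult_lt_reg_r with (2 * (INR n + 1) * X); [assumption|]. rewrite Hd2. nra. }
  pose proof (Bernoulli_sub d n ltac:(lra)) as B.
  specialize (H (1 - d) ltac:(lra)).
  assert ((1 - INR n * d) * X <= Y)
    by (eapply Rle_trans; [apply Rmult_le_compat_r; [assumption|exact B]|exact H]).
  nra.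
Qed.

Lemma trigsum_bound f c J h th ph r V : 0 < h -> 0 <= V -> (1 <= r)%nat -> 0 < th <= PI ->
  supported f c (c + INR J * h) ->
  (forall h, 0 < h -> vbound (2 * r) h f (h ^ (2 * r - 1) * V)) ->
  th ^ (2 * r) * Rabs (trigsum f c J h th ph)
  <= h ^ (2 * r - 1) * V *
     (1 + (th / (2 * PI - th)) ^ (2 * r)
      + (th / (2 * PI + th)) ^ (2 * (r - 1)) * (th / (2 * sin (th / 2))) ^ 2).
Proof.
  intros Hh HV Hr Ht Hf HB. apply le_of_pow_approx with (2 * r)%nat.
  { apply Rmult_le_pos; [apply pow_le; lra|apply Rabs_pos]. }
  intros eta He. destruct (leafw_pow_sum eta th r He Ht Hr) as [n Hn].
  pose proof (trigsum_leafw f c J h th ph n r V Hh Hr ltac:(lra) Hf HB) as B.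
  assert (Hs : 0 < sin (th / 2)) by (apply sin_gt_0; lra).
  assert (Hc : 0 <= h ^ (2 * r - 1) * V) by (apply Rmult_le_pos; [apply pow_le|]; lra).
  rewrite <- Rmult_assoc, <- Rpow_mult_distr.
  assert (Hp : 0 < (eta * th) ^ (2 * r)) by (apply pow_lt; nra).
  eapply Rle_trans; [apply Rmult_le_compat_l; [lra|exact B]|].
  rewrite <- Rmult_assoc, (Rmult_comm _ (h ^ _ * V)), Rmult_assoc.
  apply Rmult_le_compat_l; [assumption|].
  eapply Rle_trans; [apply Rmult_le_compat_l; [lra|exact Hn]|].
  rewrite Rmult_plus_distr_l, Rmult_plus_distr_l, Rinv_r by lra.
  rewrite <- pow_inv, <- Rpow_mult_distr.
  replace (eta * th * / (eta * (2 * PI - th))) with (th / (2 * PI - th)) by (field; lra).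
  apply Rplus_le_compat_l.
  replace (2 * r)%nat with (2 * (r - 1) + 2)%nat by lia.
  rewrite pow_add.
  replace ((eta * th) ^ (2 * (r - 1)) * (eta * th) ^ 2 *
     (/ (eta * (2 * PI + th)) ^ (2 * (r - 1)) * / (2 * sin (th / 2)) ^ 2))
    with (((eta * th) ^ (2 * (r - 1)) * / (eta * (2 * PI + th)) ^ (2 * (r - 1)))
          * (eta ^ 2 * (th / (2 * sin (th / 2))) ^ 2)).
  2:{ field. split; [|apply pow_nonzero; nra]. lra. }
  rewrite <- pow_inv, <- Rpow_mult_distr.
  replace (eta * th * / (eta * (2 * PI + th))) with (th / (2 * PI + th)) by (field; lra).
  apply Rmult_le_compat_l.
  - apply pow_le. apply Rmult_le_pos; [lra|left; apply Rinv_0_lt_compat; pose proof PI_RGT_0; lra].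
  - assert (eta ^ 2 <= 1) by nra. rewrite <- (Rmult_1_l ((th / _) ^ 2)) at 2.
    apply Rmult_le_compat_r; [apply pow2_ge_0|assumption].
Qed.

(** The ratios are at most 1 and r >= 3, so the powers may be lowered to the fixed exponents 6 and
    4, which makes the bound uniform in r. *)
Lemma alias_factor_le th r a b x0 : (3 <= r)%nat -> 0 < th <= PI ->
  0 <= a <= 1 -> 0 <= b <= 1 -> 0 < x0 ->
  th <= a * (2 * PI - th) -> th <= b * (2 * PI + th) -> x0 * (th / 2) <= sin (th / 2) ->
  1 + (th / (2 * PI - th)) ^ (2 * r)
    + (th / (2 * PI + th)) ^ (2 * (r - 1)) * (th / (2 * sin (th / 2))) ^ 2
  <= 1 + a ^ 6 + b ^ 4 * (/ x0) ^ 2.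
Proof.
  intros Hr Ht Ha Hb Hx H1 H2 H3.
  assert (Hq : forall q y, 0 < y -> th <= q * y -> 0 <= th / y <= q).
  { intros q y Hy H. split; [apply Rmult_le_pos; [lra|left; now apply Rinv_0_lt_compat]|].
    apply Rmult_le_reg_r with y; [assumption|]. unfold Rdiv.
    rewrite Rmult_assoc, Rinv_l, Rmult_1_r by lra. exact H. }
  assert (Hpow : forall q y k m, 0 <= y <= q -> q <= 1 -> (m <= k)%nat -> y ^ k <= q ^ m).
  { intros q y k m Hy Hq1 Hmk. apply Rle_trans with (q ^ k); [now apply pow_incr|].
    replace k with (m + (k - m))%nat by lia. rewrite pow_add.
    rewrite <- (Rmult_1_r (q ^ m)) at 2. apply Rmult_le_compat_l; [apply pow_le; lra|].
    rewrite <- (pow1 (k - m)). apply pow_incr; lra. }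
  assert (Hs : 0 < sin (th / 2)) by (apply sin_gt_0; lra).
  assert (0 < PI) by lra.
  apply Rplus_le_compat; [apply Rplus_le_compat_l|].
  - apply Hpow; [apply Hq; lra|lra|lia].
  - apply Rmult_le_compat; [apply pow_le, Hq with b; lra|apply pow2_ge_0| |].
    + apply Hpow; [apply Hq; lra|lra|lia].
    + apply pow_incr. apply Hq; [lra|].
      apply Rmult_le_reg_l with x0; [assumption|].
      replace (x0 * (/ x0 * (2 * sin (th / 2)))) with (2 * sin (th / 2)) by (field; lra). lra.
Qed.

Lemma sin_half_ge th x0 t0 : 0 < th <= PI -> th <= t0 -> x0 <= 1 - (t0 / 2) ^ 2 / 6 ->
  x0 * (th / 2) <= sin (th / 2).
Proof.
  intros Ht H0 Hx. pose proof (sin_ge_cubic (th / 2) ltac:(lra)) as B.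
  eapply Rle_trans; [|exact B]. rewrite (Rmult_comm x0). apply Rmult_le_compat_l; [lra|]. nra.
Qed.

Lemma alias_factor_PI th r : (3 <= r)%nat -> 0 < th <= PI ->
  1 + (th / (2 * PI - th)) ^ (2 * r)
    + (th / (2 * PI + th)) ^ (2 * (r - 1)) * (th / (2 * sin (th / 2))) ^ 2 <= 2036 / 1000.
Proof.
  intros Hr Ht. pose proof PI_lt_315.
  eapply Rle_trans.
  (* At th = pi the ratios are 1 and 1/3, and x0 lies below 1 - (3.15/2)^2/6. *)
  - apply alias_factor_le with (a := 1) (b := 1 / 3) (x0 := 5865 / 10000); try assumption; try lra.
    apply sin_half_ge with (t0 := 315 / 100); lra.
  - lra.
Qed.

Lemma alias_factor_PI2 th r : (3 <= r)%nat -> 0 < th <= PI / 2 ->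
  1 + (th / (2 * PI - th)) ^ (2 * r)
    + (th / (2 * PI + th)) ^ (2 * (r - 1)) * (th / (2 * sin (th / 2))) ^ 2 <= 1004 / 1000.
Proof.
  intros Hr Ht. pose proof PI_lt_315.
  eapply Rle_trans.
  (* At th = pi/2 the ratios are 1/3 and 1/5. *)
  - apply alias_factor_le with (a := 1 / 3) (b := 1 / 5) (x0 := 89 / 100); try assumption; try lra.
    apply sin_half_ge with (t0 := 1575 / 1000); lra.
  - lra.
Qed.


(** * The normalising constant *)

Lemma supported_spline s : (2 <= s)%nat -> supported (tspl s 0 (s - 1)) (-1) 1.
Proof.
  intros Hs x [Hx|Hx].
  - destruct s as [|[|n]]; try lia. replace (S (S n) - 1)%nat with (S n) by lia.
    now apply tspl_left.
  - apply tspl_right_0; [lia|assumption].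
Qed.

Lemma supported_mul f a b : supported f a b -> supported (fun x => x * f x) a b.
Proof. intros H x Hx. rewrite (H x Hx). ring. Qed.

(** The size of C is immaterial: it becomes a Lipschitz constant in a Riemann sum error that tends
    to zero. *)
Lemma tspl_bounded s p : (S p < s)%nat -> exists C, 0 <= C /\ forall x, Rabs (tspl s 0 (S p) x) <= C.
Proof.
  induction p as [|p IH]; intros Hp.
  - exists (tau s). split; [left; apply tau_pos; lia|]. intros; apply tspl_1_bound; lia.
  - destruct IH as [C [HC B]]; [lia|]. exists (C * 2). split; [lra|]. intros x.
    rewrite <- tspl_clamp by lia. pose proof (clamp_bound x) as Hc.
    destruct (Req_dec (clamp x) (-1)) as [E|E].
    + rewrite E, tspl_left, Rabs_R0 by lra. lra.
    + destruct (MVT_cor2 (tspl s 0 (S (S p))) (tspl s 0 (S p)) (-1) (clamp x)) as [xi [Hxi _]].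
      { lra. }
      { intros; apply derivable_tspl. }
      rewrite (tspl_left s 0 (S p) (-1)), Rminus_0_r in Hxi by lra.
      rewrite Hxi, Rabs_mult. apply Rmult_le_compat; try apply Rabs_pos; [apply B|].
      rewrite Rabs_right; lra.
Qed.

Lemma riemann_sum_error G g c J h C : 0 < h ->
  (forall x, derivable_pt_lim G x (g x)) ->
  (forall x y, Rabs (g x - g y) <= C * Rabs (x - y)) ->
  Rabs (h * rsum (fun j => g (c + INR j * h)) J - (G (c + INR J * h) - G c))
  <= INR J * (C * (h * h)).
Proof.
  intros Hh HG Hg.
  assert (E : G (c + INR J * h) - G c
     = rsum (fun j => G (c + INR (S j) * h) - G (c + INR j * h)) J).
  { rewrite (rsum_telescope (fun j => G (c + INR j * h))). simpl INR at 3.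
    rewrite Rmult_0_l, Rplus_0_r. reflexivity. }
  rewrite E, <- rsum_scal, <- rsum_minus, <- rsum_const.
  eapply Rle_trans; [apply rsum_Rabs|]. apply rsum_le; intros j _.
  destruct (MVT_cor2 G g (c + INR j * h) (c + INR (S j) * h)) as [xi [Hxi Hb]].
  { rewrite S_INR. lra. }
  { intros; apply HG. }
  rewrite S_INR in *. rewrite Hxi.
  replace (h * g (c + INR j * h) - g xi * (c + (INR j + 1) * h - (c + INR j * h)))
    with (h * (g (c + INR j * h) - g xi)) by ring.
  rewrite Rabs_mult, (Rabs_right h) by lra.
  replace (C * (h * h)) with (h * (C * h)) by ring.
  apply Rmult_le_compat_l; [lra|]. eapply Rle_trans; [apply Hg|].
  assert (0 <= C).
  { pose proof (Hg 1 0) as H1. pose proof (Rabs_pos (g 1 - g 0)).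
    rewrite Rminus_0_r, Rabs_R1 in H1. lra. }
  apply Rmult_le_compat_l; [assumption|]. rewrite Rabs_left by lra. lra.
Qed.

Lemma spline_lipschitz s : (3 <= s)%nat ->
  exists C, forall x y, Rabs (tspl s 0 (s - 1) x - tspl s 0 (s - 1) y) <= C * Rabs (x - y).
Proof.
  intros Hs. destruct (tspl_bounded s (s - 3)) as [C [HC B]]; [lia|]. exists C.
  replace (s - 1)%nat with (S (S (s - 3))) by lia.
  assert (L : forall x y, x < y ->
     Rabs (tspl s 0 (S (S (s - 3))) y - tspl s 0 (S (S (s - 3))) x) <= C * Rabs (y - x)).
  { intros x y Hxy.
    destruct (MVT_cor2 (tspl s 0 (S (S (s - 3)))) (tspl s 0 (S (s - 3))) x y Hxy) as [xi [Hxi _]].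
    { intros; apply derivable_tspl. }
    rewrite Hxi, Rabs_mult. apply Rmult_le_compat_r; [apply Rabs_pos|apply B]. }
  intros x y. destruct (Rtotal_order x y) as [H|[->|H]].
  - rewrite Rabs_minus_sym, (Rabs_minus_sym x). now apply L.
  - rewrite !Rminus_diag, Rabs_R0. lra.
  - now apply L.
Qed.

(** The antiderivative [tspl s 0 s] at 1 is a polynomial moment of degree exactly [s], so only the
    top moment 2s/2^(s-1) survives. *)
Lemma spline_integral s : (2 <= s)%nat -> Nat.Even s ->
  tspl s 0 s 1 - tspl s 0 s (-1) = 4 / (2 ^ s * INR (fact (s - 1))).
Proof.
  intros Hs [m Hm]. rewrite tspl_right by lra.
  rewrite altf_shift_eq, altf_pow_eq by lia.
  replace ((-1) ^ s) with 1 by (rewrite Hm; symmetry; apply pow_1_even).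
  destruct s as [|n]; [lia|]. rewrite tspl_left by lra.
  replace (S n - 1)%nat with n by lia. rewrite (fact_simpl n), mult_INR. simpl (2 ^ S n). field.
  repeat split; [apply INR_fact_neq_0|apply pow_nonzero; lra|apply not_0_INR; lia].
Qed.

Lemma le_of_dyadic_approx X Y K : (forall n, X - K / 2 ^ n <= Y) -> X <= Y.
Proof.
  intros H. destruct (Rle_dec X Y) as [Hle|Hgt]; [assumption|exfalso].
  destruct (INR_unbounded (K / (X - Y))) as [n Hn]. specialize (H n).
  assert (P : 0 < 2 ^ n) by (apply pow_lt; lra).
  assert (Hnn : INR n <= 2 ^ n).
  { replace (2 ^ n) with (INR (2 ^ n)) by now rewrite pow_INR.
    apply le_INR. pose proof (Nat.pow_gt_lin_r 2 n). lia. }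
  assert (K < 2 ^ n * (X - Y)).
  { apply Rmult_lt_reg_r with (/ (X - Y)); [apply Rinv_0_lt_compat; lra|].
    rewrite Rmult_assoc, Rinv_r by lra. unfold Rdiv in Hn. lra. }
  assert (K / 2 ^ n < X - Y).
  { apply Rmult_lt_reg_r with (2 ^ n); [assumption|]. unfold Rdiv.
    rewrite Rmult_assoc, Rinv_l by lra. lra. }
  lra.
Qed.

(** Halving the step at frequency 0 adds a sum at frequency pi, where 2 sin(pi/2) = 2 and [s]
    summations by parts gain 2^(-s). The first halving costs at most 2 s h^s/4^s, half of the
    allowance. *)
Lemma spline_sum_refine s n : (2 <= s)%nat -> forall J h, 0 < h -> INR J * h = 2 ->
  h / 2 ^ n * trigsum (tspl s 0 (s - 1)) (-1) (2 ^ n * J) (h / 2 ^ n) 0 0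
    - 4 * INR s * h ^ s / 4 ^ s
  <= h * trigsum (tspl s 0 (s - 1)) (-1) J h 0 0.
Proof.
  intros Hs. assert (Hs0 : 0 < INR s) by (apply lt_0_INR; lia).
  assert (P4 : 0 < 4 ^ s) by (apply pow_lt; lra).
  assert (P2 : 4 <= 2 ^ s).
  { replace 4 with (2 ^ 2) by ring. apply Rle_pow; [lra|lia]. }
  induction n as [|n IH]; intros J h Hh HJ.
  - simpl. rewrite Nat.add_0_r. replace (h / 1) with h by field.
    assert (0 < h ^ s) by now apply pow_lt.
    assert (0 <= 4 * INR s * h ^ s / 4 ^ s)
      by (apply Rmult_le_pos; [nra|left; now apply Rinv_0_lt_compat]).
    lra.
  - rewrite (trigsum_halve _ _ J). replace (0 / 2) with 0 by field. rewrite Rplus_0_l.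
    set (g := tspl s 0 (s - 1)) in *.
    assert (HJ2 : INR (2 * J) * (h / 2) = 2) by (rewrite mult_INR; simpl; lra).
    specialize (IH (2 * J)%nat (h / 2) ltac:(lra) HJ2).
    replace (2 ^ n * (2 * J))%nat with (2 ^ S n * J)%nat in IH by (simpl; lia).
    replace (h / 2 / 2 ^ n) with (h / 2 ^ S n) in IH
      by (simpl; field; apply pow_nonzero; lra).
    pose proof (trigsum_vbound g s (h / 2) PI (-1) (2 * J) 0 ((h / 2) ^ (s - 1) * (2 * INR s))
                  ltac:(lra)) as B.
    rewrite HJ2, sin_PI2 in B. replace (-1 + 2) with 1 in B by ring.
    specialize (B (supported_spline s Hs) (vbound_spline s (h / 2) Hs ltac:(lra))).
    replace (Rabs (2 * 1)) with 2 in B by (rewrite Rabs_right; lra).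
    set (T := trigsum g (-1) (2 * J) (h / 2) PI 0) in *.
    set (T0 := trigsum g (-1) (2 * J) (h / 2) 0 0) in *.
    assert (E : (h / 2) ^ s = h / 2 * (h / 2) ^ (s - 1)).
    { replace s with (S (s - 1)) at 1 by lia. reflexivity. }
    assert (E2 : (h / 2) ^ s = h ^ s / 2 ^ s).
    { unfold Rdiv. now rewrite Rpow_mult_distr, pow_inv. }
    assert (E4 : 4 ^ s = 2 ^ s * 2 ^ s) by (rewrite <- Rpow_mult_distr; f_equal; ring).
    assert (Hhs : 0 < h ^ s) by now apply pow_lt.
    assert (Q : 2 ^ s * (h / 2 * Rabs T) <= 2 * INR s * (h ^ s / 2 ^ s)).
    { rewrite <- E2, E. apply Rmult_le_compat_l with (r := h / 2) in B; [|lra]. lra. }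
    assert (Q2 : h / 2 * Rabs T <= 2 * INR s * h ^ s / 4 ^ s).
    { apply Rmult_le_reg_l with (2 ^ s); [lra|]. eapply Rle_trans; [exact Q|].
      right. rewrite E4. field. lra. }
    (* All further halvings together fit into the other half, since (h/2)^s <= h^s/4. *)
    assert (Q3 : 4 * INR s * (h / 2) ^ s / 4 ^ s <= 2 * INR s * h ^ s / 4 ^ s).
    { apply Rmult_le_compat_r; [left; now apply Rinv_0_lt_compat|]. rewrite E2.
      assert (h ^ s / 2 ^ s <= h ^ s / 4).
      { apply Rmult_le_compat_l; [lra|]. apply Rinv_le_contravar; lra. }
      nra. }
    pose proof (Rle_abs (- T)) as A. rewrite Rabs_Ropp in A.
    assert (A2 : h / 2 * - T <= h / 2 * Rabs T) by (apply Rmult_le_compat_l; lra).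
    lra.
Qed.

Lemma spline_sum_lower s J h : (3 <= s)%nat -> Nat.Even s -> 0 < h -> INR J * h = 2 ->
  4 / (2 ^ s * INR (fact (s - 1))) - 4 * INR s * h ^ s / 4 ^ s
  <= h * trigsum (tspl s 0 (s - 1)) (-1) J h 0 0.
Proof.
  intros Hs He Hh HJ. destruct (spline_lipschitz s Hs) as [C HC].
  apply le_of_dyadic_approx with (K := 2 * C * h). intros n.
  pose proof (spline_sum_refine s n ltac:(lia) J h Hh HJ) as B.
  assert (P : 0 < 2 ^ n) by (apply pow_lt; lra).
  assert (Hh' : 0 < h / 2 ^ n) by now apply Rdiv_lt_0_compat.
  pose proof (riemann_sum_error (tspl s 0 s) (tspl s 0 (s - 1)) (-1) (2 ^ n * J) (h / 2 ^ n) C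
     Hh') as Rm.
  assert (HJn : INR (2 ^ n * J) * (h / 2 ^ n) = 2).
  { rewrite mult_INR, pow_INR. simpl (INR 2). replace (1 + 1) with 2 by ring.
    transitivity (INR J * h); [field; lra|exact HJ]. }
  rewrite HJn in Rm. replace (-1 + 2) with 1 in Rm by ring.
  rewrite spline_integral in Rm by (assumption || lia).
  assert (HD : forall x, derivable_pt_lim (tspl s 0 s) x (tspl s 0 (s - 1) x)).
  { intros x. replace s with (S (S (s - 2))) at 2 by lia.
    replace (s - 1)%nat with (S (s - 2)) by lia. apply derivable_tspl. }
  specialize (Rm HD HC).
  replace (INR (2 ^ n * J) * (C * (h / 2 ^ n * (h / 2 ^ n)))) with (2 * C * h / 2 ^ n) in Rm.
  2:{ transitivity (INR (2 ^ n * J) * (h / 2 ^ n) * (C * (h / 2 ^ n))); [rewrite HJn; field; lra|ring]. }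
  assert (Et : trigsum (tspl s 0 (s - 1)) (-1) (2 ^ n * J) (h / 2 ^ n) 0 0
     = rsum (fun j => tspl s 0 (s - 1) (-1 + INR j * (h / 2 ^ n))) (2 ^ n * J)).
  { unfold trigsum. rewrite rsum_S_r, HJn.
    rewrite (supported_spline s ltac:(lia) (-1 + 2)) by (right; lra).
    rewrite Rmult_0_l, Rplus_0_r. apply rsum_ext; intros j _.
    rewrite Rmult_0_r, Rplus_0_l, cos_0. ring. }
  rewrite Et in B. apply Rcomplements.Rabs_le_between in Rm. lra.
Qed.

Lemma fact_le_pow n : INR (fact n) <= INR n ^ n.
Proof.
  induction n as [|n IH]; [simpl; lra|].
  rewrite fact_simpl, mult_INR. cbn [pow]. apply Rmult_le_compat_l; [apply pos_INR|].
  eapply Rle_trans; [exact IH|]. apply pow_incr. split; [apply pos_INR|apply le_INR; lia].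
Qed.

(** With h = 1/(N+1) the relative error is s!/(2(N+1))^s <= (s/(2(N+1)))^s <= 4^(-s) <= 1/4096, by
    s! <= s^s and N >= 2s. *)
Lemma spline_sum_lower_rel s N : (6 <= s)%nat -> Nat.Even s -> (2 * s <= N)%nat ->
  4095 / 4096 * (4 / (2 ^ s * INR (fact (s - 1)))) * INR (N + 1)
  <= trigsum (tspl s 0 (s - 1)) (-1) (2 * (N + 1)) (/ INR (N + 1)) 0 0.
Proof.
  intros Hs He HN. set (n1 := INR (N + 1)).
  assert (Hn1 : 2 * INR s <= n1).
  { unfold n1. rewrite <- (mult_INR 2). apply le_INR; lia. }
  assert (Hs6 : 6 <= INR s) by (apply (le_INR 6) in Hs; simpl in Hs; lra).
  assert (Hn0 : 0 < n1) by lra.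
  assert (Hh : 0 < / n1) by now apply Rinv_0_lt_compat.
  pose proof (spline_sum_lower s (2 * (N + 1)) (/ n1) ltac:(lia) He Hh) as B.
  assert (HJ : INR (2 * (N + 1)) * / n1 = 2).
  { rewrite mult_INR. fold n1. simpl (INR 2). field. lra. }
  specialize (B HJ).
  set (T := trigsum _ _ _ _ _ _) in *.
  assert (F0 : 0 < INR (fact (s - 1))) by apply INR_fact_lt_0.
  assert (P2 : 0 < 2 ^ s) by (apply pow_lt; lra).
  assert (E4 : 4 ^ s = 2 ^ s * 2 ^ s) by (rewrite <- Rpow_mult_distr; f_equal; ring).
  assert (P64 : 4096 <= 4 ^ s).
  { replace 4096 with (4 ^ 6) by ring. apply Rle_pow; [lra|assumption]. }
  assert (Fs : INR (fact s) = INR s * INR (fact (s - 1))).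
  { replace s with (S (s - 1)) at 1 2 by lia. rewrite fact_simpl, mult_INR. reflexivity. }
  pose proof (fact_le_pow s) as Ff. rewrite Fs in Ff.
  assert (Hpow : (2 * INR s) ^ s <= n1 ^ s) by (apply pow_incr; lra).
  rewrite Rpow_mult_distr in Hpow.
  assert (Pn : 0 < n1 ^ s) by now apply pow_lt.
  assert (Key : 4 * INR s * (/ n1) ^ s / 4 ^ s <= / 4096 * (4 / (2 ^ s * INR (fact (s - 1))))).
  { rewrite pow_inv.
    apply Rmult_le_reg_r with (n1 ^ s * 4 ^ s * INR (fact (s - 1)));
      [apply Rmult_lt_0_compat; [nra|assumption]|].
    replace (4 * INR s * / n1 ^ s / 4 ^ s * (n1 ^ s * 4 ^ s * INR (fact (s - 1))))
      with (4 * (INR s * INR (fact (s - 1)))) by (field; lra).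
    replace (/ 4096 * (4 / (2 ^ s * INR (fact (s - 1)))) * (n1 ^ s * 4 ^ s * INR (fact (s - 1))))
      with (4 * (n1 ^ s * 2 ^ s) / 4096) by (rewrite E4; field; lra).
    assert (2 ^ s * (2 ^ s * INR s ^ s) <= 2 ^ s * n1 ^ s) by (apply Rmult_le_compat_l; lra).
    assert (0 <= INR s ^ s) by (apply pow_le; lra).
    assert (4096 * INR s ^ s <= 4 ^ s * INR s ^ s) by (apply Rmult_le_compat_r; lra).
    rewrite E4 in *. lra. }
  apply Rmult_le_reg_l with (/ n1); [assumption|].
  replace (/ n1 * (4095 / 4096 * (4 / (2 ^ s * INR (fact (s - 1)))) * n1))
    with (4095 / 4096 * (4 / (2 ^ s * INR (fact (s - 1))))) by (field; lra).
  lra.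
Qed.


(** * The localised kernel on the circle *)

(** Before norming, the p-th derivative of the kernel is the case of phase p pi/2: each derivative
    brings a factor k and advances the phase by pi/2. *)
Definition ksum (s N p : nat) (t ph : R) : R :=
  rsum (fun j => coef s N j * kval N j ^ p * cos (kval N j * t + ph)) (S (2 * N)).

Lemma kval_INR N j : kval N j = INR (S j) - INR (N + 1).
Proof.
  unfold kval. rewrite minus_IZR, <- !INR_IZR_INZ, S_INR, plus_INR. simpl. ring.
Qed.

Lemma coef_tspl s N j : (2 <= s)%nat -> Nat.Even s ->
  coef s N j = tspl s 0 (s - 1) (kval N j * / INR (N + 1)).
Proof.
  intros Hs He. unfold coef, gtilde. rewrite gspline_tspl by assumption. f_equal.
  unfold kval. field. apply not_0_INR; lia.
Qed.

Lemma ksum_trigsum s N p F t ph : (2 <= s)%nat -> Nat.Even s -> supported F (-1) 1 ->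
  (forall x, F x = x ^ p * tspl s 0 (s - 1) x) ->
  ksum s N p t ph
  = INR (N + 1) ^ p
    * trigsum F (-1) (2 * (N + 1)) (/ INR (N + 1)) t (ph - INR (N + 1) * t).
Proof.
  intros Hs He HF HE. assert (Hn : INR (N + 1) <> 0) by (apply not_0_INR; lia).
  (* The samples k = -N..N are padded by the zero samples k = -(N+1) and k = N+1, so that the window
     is exactly the support [-1,1]. *)
  unfold trigsum, ksum. replace (2 * (N + 1))%nat with (S (S (2 * N))) by lia.
  rewrite (rsum_S_l _ (S (S (2 * N)))), (rsum_S_r _ (S (2 * N))).
  rewrite (HF (-1 + INR 0 * / INR (N + 1))) by (simpl; lra).
  rewrite (HF (-1 + INR (S (S (2 * N))) * / INR (N + 1))).
  2:{ right. right. replace (S (S (2 * N))) with (2 * (N + 1))%nat by lia.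
      rewrite mult_INR. simpl (INR 2). field. assumption. }
  rewrite !Rmult_0_l, Rplus_0_l, Rplus_0_r, <- rsum_scal. apply rsum_ext; intros j _.
  rewrite coef_tspl, HE by assumption.
  replace (-1 + INR (S j) * / INR (N + 1)) with (kval N j * / INR (N + 1))
    by (rewrite kval_INR; field; assumption).
  replace (INR (S j) * t + (ph - INR (N + 1) * t)) with (kval N j * t + ph)
    by (rewrite kval_INR; ring).
  rewrite Rpow_mult_distr, pow_inv. field. now apply pow_nonzero.
Qed.

Lemma gnorm_ksum s N : gnorm s N = ksum s N 0 0 0.
Proof.
  unfold gnorm, ksum. rewrite sum_f_R0_rsum. apply rsum_ext; intros j _.
  rewrite Rmult_0_r, Rplus_0_l, cos_0. simpl. ring.
Qed.

Lemma sigt_re_ksum s N t : sigt_re s N t = / gnorm s N * ksum s N 0 t 0.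
Proof.
  unfold sigt_re, ksum. rewrite sum_f_R0_rsum. f_equal. apply rsum_ext; intros j _.
  rewrite Rplus_0_r. simpl. ring.
Qed.

Lemma kval_reflect N j : (j <= 2 * N)%nat -> kval N (2 * N - j) = - kval N j.
Proof.
  intros Hj. rewrite !kval_INR, !S_INR, minus_INR, mult_INR, plus_INR by assumption.
  simpl. ring.
Qed.

Lemma sigt_im_0 s N t : (2 <= s)%nat -> Nat.Even s -> sigt_im s N t = 0.
Proof.
  intros Hs He. unfold sigt_im. rewrite sum_f_R0_rsum.
  set (F := fun j => coef s N j * sin (kval N j * t)).
  assert (E : rsum F (S (2 * N)) = - rsum F (S (2 * N))).
  { rewrite rsum_rev at 1. replace (- rsum F (S (2 * N))) with (-1 * rsum F (S (2 * N))) by ring.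
    rewrite <- rsum_scal. apply rsum_ext; intros j Hj. unfold F.
    replace (S (2 * N) - 1 - j)%nat with (2 * N - j)%nat by lia.
    rewrite !coef_tspl, kval_reflect by (assumption || lia).
    rewrite !Ropp_mult_distr_l_reverse, tspl_even, sin_neg; [ring|assumption| |lia].
    destruct He as [m Hm]. exists (m - 1)%nat. lia. }
  replace (rsum F (S (2 * N))) with 0 by lra. ring.
Qed.

Lemma derivable_ksum s N p ph t :
  derivable_pt_lim (fun t => ksum s N p t ph) t (ksum s N (S p) t (ph + PI / 2)).
Proof.
  unfold ksum.
  apply (derivable_rsum (fun j t => coef s N j * kval N j ^ p * cos (kval N j * t + ph))).
  intros j. set (k := kval N j). apply is_derive_Reals. auto_derive; [trivial|].
  replace (k * t + (ph + PI / 2)) with (PI / 2 + (k * t + ph)) by ring.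
  rewrite (cos_plus (PI / 2)), cos_PI2, sin_PI2. simpl. ring.
Qed.

(** The numerator is at most (N+1)^p h^(s-1) V W / t^s with h = 1/(N+1), and the norm is at least
    4095/4096 of (N+1) times the integral; this is the origin of V/4 and 4096/4095. W stands for any
    bound of the alias factor. *)
Lemma kernel_bound s N p F V W t ph : (6 <= s)%nat -> Nat.Even s -> (2 * s <= N)%nat ->
  0 < t <= PI -> supported F (-1) 1 -> 0 <= V ->
  (forall x, F x = x ^ p * tspl s 0 (s - 1) x) ->
  (forall h, 0 < h -> vbound s h F (h ^ (s - 1) * V)) ->
  1 + (t / (2 * PI - t)) ^ s
    + (t / (2 * PI + t)) ^ (s - 2) * (t / (2 * sin (t / 2))) ^ 2 <= W ->
  Rabs (/ gnorm s N * ksum s N p t ph)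
  <= 4096 / 4095 * W * V / 4 * (INR (N + 1) ^ p / INR (N + 1) ^ 2)
     * (INR (fact (s - 1)) * 2 ^ s / (INR (N + 1) ^ (s - 2) * t ^ s)).
Proof.
  intros Hs He HN Ht HF HV HE HB HW. pose proof He as [r Hr].
  assert (Hn0 : 0 < INR (N + 1)) by (apply lt_0_INR; lia).
  assert (F0 : 0 < INR (fact (s - 1))) by apply INR_fact_lt_0.
  assert (P2 : 0 < 2 ^ s) by (apply pow_lt; lra).
  assert (Pt : 0 < t ^ s) by (apply pow_lt; lra).
  pose proof (spline_sum_lower_rel s N Hs He HN) as L.
  assert (G : gnorm s N
     = trigsum (tspl s 0 (s - 1)) (-1) (2 * (N + 1)) (/ INR (N + 1)) 0 0).
  { rewrite gnorm_ksum, (ksum_trigsum s N 0 (tspl s 0 (s - 1))) by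
      (assumption || lia || (apply supported_spline; lia) || (intros; simpl; ring)).
    simpl pow. rewrite Rmult_1_l. f_equal. ring. }
  rewrite <- G in L. clear G.
  set (n1 := INR (N + 1)) in *.
  assert (Pn : forall k, 0 < n1 ^ k) by (intros; now apply pow_lt).
  assert (L0 : 0 < 4095 / 4096 * (4 / (2 ^ s * INR (fact (s - 1)))) * n1).
  { repeat apply Rmult_lt_0_compat; try lra. apply Rinv_0_lt_compat. nra. }
  assert (Gi : 0 < / gnorm s N <= 4096 / 4095 * (2 ^ s * INR (fact (s - 1))) / (4 * n1)).
  { split; [apply Rinv_0_lt_compat; lra|].
    replace (4096 / 4095 * (2 ^ s * INR (fact (s - 1))) / (4 * n1))
      with (/ (4095 / 4096 * (4 / (2 ^ s * INR (fact (s - 1)))) * n1)) by (field; lra).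
    now apply Rinv_le_contravar. }
  rewrite (ksum_trigsum s N p F) by (assumption || lia). fold n1.
  assert (HJ : -1 + INR (2 * (N + 1)) * / n1 = 1).
  { rewrite mult_INR. fold n1. simpl (INR 2). field. lra. }
  pose proof (trigsum_bound F (-1) (2 * (N + 1)) (/ n1) t (ph - n1 * t) r V) as B.
  rewrite HJ in B. replace (2 * (r - 1))%nat with (s - 2)%nat in B by lia.
  rewrite <- Hr in B.
  specialize (B (Rinv_0_lt_compat _ Hn0) HV ltac:(lia) Ht HF HB).
  set (T := trigsum F _ _ _ _ _) in *.
  assert (B2 : t ^ s * Rabs T <= (/ n1) ^ (s - 1) * V * W).
  { eapply Rle_trans; [exact B|]. apply Rmult_le_compat_l; [|exact HW].
    apply Rmult_le_pos; [apply pow_le; left; now apply Rinv_0_lt_compat|assumption]. }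
  rewrite Rabs_mult, (Rabs_right (/ gnorm s N)), Rabs_mult, (Rabs_right (n1 ^ p))
    by (left; (apply Pn || lra)).
  apply Rmult_le_reg_l with (t ^ s); [assumption|].
  replace (t ^ s * (/ gnorm s N * (n1 ^ p * Rabs T)))
    with (/ gnorm s N * n1 ^ p * (t ^ s * Rabs T)) by ring.
  assert (B3 : 0 <= t ^ s * Rabs T) by (apply Rmult_le_pos; [lra|apply Rabs_pos]).
  apply Rle_trans with (4096 / 4095 * (2 ^ s * INR (fact (s - 1))) / (4 * n1) * n1 ^ p
                        * ((/ n1) ^ (s - 1) * V * W)).
  - apply Rmult_le_compat; [|assumption| |assumption].
    + apply Rmult_le_pos; [lra|left; apply Pn].
    + apply Rmult_le_compat_r; [left; apply Pn|lra].
  - right. rewrite pow_inv.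
    replace (n1 ^ (s - 1)) with (n1 * n1 ^ (s - 2))
      by (replace (s - 1)%nat with (S (s - 2)) by lia; reflexivity).
    field. repeat split; try lra. apply Rgt_not_eq, Pn.
Qed.

Lemma cos_ge_quadratic x : 0 <= x -> 1 - x ^ 2 / 2 <= cos x.
Proof.
  intros Hx. assert (E : cos x = 1 - 2 * (sin (x / 2) * sin (x / 2))).
  { replace x with (2 * (x / 2)) at 1 by field. rewrite cos_2a_sin. ring. }
  assert (A : Rabs (sin (x / 2)) <= x / 2).
  { destruct (Req_dec x 0) as [->|H0].
    - replace (0 / 2) with 0 by field. rewrite sin_0, Rabs_R0. lra.
    - destruct (Rle_dec (x / 2) PI).
      + pose proof (sin_ge_0 (x / 2) ltac:(lra) ltac:(lra)).
        rewrite Rabs_right by lra. left. apply sin_lt_x. lra.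
      + pose proof PI2_1. apply Rle_trans with 1; [apply Rabs_le, SIN_bound|lra]. }
  assert (B : sin (x / 2) * sin (x / 2) <= x / 2 * (x / 2)).
  { rewrite <- (Rabs_right (sin (x / 2) * sin (x / 2))) by nra.
    rewrite Rabs_mult. apply Rmult_le_compat; try apply Rabs_pos; assumption. }
  rewrite E. nra.
Qed.

(** The angle is at most 3.15/12 = 0.2625, where the cosine is at least 0.9655, and 1.575/0.9655 <
    1.6313. *)
Lemma s_tau_bound s : (6 <= s)%nat -> INR s * tau s <= 16313 / 10000.
Proof.
  intros Hs. assert (H6 : 6 <= INR s) by (apply (le_INR 6) in Hs; simpl in Hs; lra).
  pose proof PI_lt_315. pose proof PI_RGT_0.
  pose proof (tau_angle s ltac:(lia)) as Ha. unfold tau, tan.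
  assert (Hal : INR s * (PI / (2 * INR s)) = PI / 2) by (field; lra).
  set (al := PI / (2 * INR s)) in *.
  assert (al <= 2625 / 10000) by nra.
  pose proof (cos_ge_quadratic al ltac:(lra)) as C.
  pose proof (sin_lt_x al ltac:(lra)) as S.
  assert (9655 / 10000 <= cos al) by nra.
  apply Rmult_le_reg_r with (cos al); [lra|].
  replace (INR s * (sin al / cos al) * cos al) with (INR s * sin al) by (field; lra).
  nra.
Qed.

(** The weight 1/t + 1/2 is the one with which the first derivative enters the mixed second
    derivative on the group, see [hessian_bound]. *)
Lemma kernel_bounds s N t ph ph' : (6 <= s)%nat -> Nat.Even s -> (2 * s <= N)%nat ->
  PI / (2 * INR (N + 1)) <= t <= PI ->
  Rabs (/ gnorm s N * ksum s N 1 t ph) <= cst1 s / (INR (N + 1) ^ (s - 1) * t ^ s) /\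
  Rabs (/ gnorm s N * ksum s N 2 t ph')
    + Rabs (/ gnorm s N * ksum s N 1 t ph) * (1 / t + 1 / 2)
  <= cst2 s / (INR (N + 1) ^ (s - 2) * t ^ s).
Proof.
  intros Hs He HN Ht. pose proof He as [r Hr].
  assert (H6 : 6 <= INR s) by (apply (le_INR 6) in Hs; simpl in Hs; lra).
  pose proof PI_RGT_0 as HPI. pose proof PI_lt_315 as HPI'. pose proof PI2_3_2 as HPI3.
  set (n1 := INR (N + 1)) in *.
  assert (Hn1 : 2 * INR s + 1 <= n1).
  { unfold n1. rewrite plus_INR, <- (mult_INR 2). simpl (INR 1).
    apply Rplus_le_compat_r, le_INR; lia. }
  assert (Ht0 : 0 < t).
  { eapply Rlt_le_trans; [|apply Ht]. apply Rdiv_lt_0_compat; lra. }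
  assert (Hti : 1 / t <= 2 / 3 * n1).
  { apply Rmult_le_reg_r with t; [assumption|].
    replace (1 / t * t) with 1 by (field; lra).
    assert (PI <= t * (2 * n1)).
    { destruct Ht as [Ht _]. apply Rmult_le_compat_r with (r := 2 * n1) in Ht; [|lra].
      replace (PI / (2 * n1) * (2 * n1)) with PI in Ht by (field; lra). lra. }
    lra. }
  set (V2 := 2 * INR s * (INR s + 1) * tau s + 2 * INR s * (1 + 2 * tau s) + INR s).
  assert (HV2 : 0 <= V2 <= 62626 / 10000 * INR s + 98 / 10).
  { pose proof (s_tau_bound s Hs) as Hst. pose proof (tau_pos s ltac:(lia)). unfold V2.
    set (q := INR s * tau s) in *.
    replace (2 * INR s * (INR s + 1) * tau s + 2 * INR s * (1 + 2 * tau s) + INR s)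
      with (q * (2 * INR s + 6) + 3 * INR s) by (unfold q; ring).
    assert (0 <= q) by (unfold q; apply Rmult_le_pos; lra). nra. }
  assert (Pn : forall k, 0 < n1 ^ k) by (intros; apply pow_lt; lra).
  assert (Pt : 0 < t ^ s) by now apply pow_lt.
  assert (F0 : 0 < INR (fact (s - 1))) by apply INR_fact_lt_0.
  assert (P2 : 0 < 2 ^ s) by (apply pow_lt; lra).
  set (U := INR (fact (s - 1)) * 2 ^ s / (n1 ^ (s - 2) * t ^ s)).
  assert (HU : 0 < U).
  { apply Rdiv_lt_0_compat; [nra|]. apply Rmult_lt_0_compat; [apply Pn|assumption]. }
  assert (En : n1 ^ (s - 1) = n1 * n1 ^ (s - 2))
    by (replace (s - 1)%nat with (S (s - 2)) by lia; reflexivity).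
  assert (HS : supported (tspl s 0 (s - 1)) (-1) 1) by (apply supported_spline; lia).
  assert (K1 : forall W, 1 + (t / (2 * PI - t)) ^ s
       + (t / (2 * PI + t)) ^ (s - 2) * (t / (2 * sin (t / 2))) ^ 2 <= W ->
     Rabs (/ gnorm s N * ksum s N 1 t ph) <= 4096 / 4095 * W * INR s / n1 * U).
  { intros W HW.
    replace (4096 / 4095 * W * INR s / n1 * U)
      with (4096 / 4095 * W * (4 * INR s) / 4 * (n1 ^ 1 / n1 ^ 2) * U) by (simpl; field; lra).
    apply (kernel_bound s N 1 (fun x => x * tspl s 0 (s - 1) x)); try assumption; try lra.
    - now apply supported_mul.
    - intros; simpl; ring.
    - intros; apply vbound_x_spline; [lia|assumption]. }
  assert (K2 : forall W, 1 + (t / (2 * PI - t)) ^ s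
       + (t / (2 * PI + t)) ^ (s - 2) * (t / (2 * sin (t / 2))) ^ 2 <= W ->
     Rabs (/ gnorm s N * ksum s N 2 t ph') <= 4096 / 4095 * W * V2 / 4 * U).
  { intros W HW.
    replace (4096 / 4095 * W * V2 / 4 * U)
      with (4096 / 4095 * W * V2 / 4 * (n1 ^ 2 / n1 ^ 2) * U) by (simpl; field; lra).
    apply (kernel_bound s N 2 (fun x => x * (x * tspl s 0 (s - 1) x)));
      try assumption; try lra.
    - apply (supported_mul (fun x => x * tspl s 0 (s - 1) x)). now apply supported_mul.
    - intros; simpl; ring.
    - intros; apply vbound_xx_spline; [lia|assumption]. }
  assert (Wpi : 1 + (t / (2 * PI - t)) ^ s
       + (t / (2 * PI + t)) ^ (s - 2) * (t / (2 * sin (t / 2))) ^ 2 <= 2036 / 1000).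
  { pose proof (alias_factor_PI t r ltac:(lia) ltac:(lra)) as A.
    replace (2 * (r - 1))%nat with (s - 2)%nat in A by lia. now rewrite <- Hr in A. }
  split.
  - eapply Rle_trans; [apply (K1 _ Wpi)|]. unfold cst1. rewrite En.
    replace (102 / 100 * INR (fact (s - 1)) * 2 ^ s * (2 * INR s) / (n1 * n1 ^ (s - 2) * t ^ s))
      with (102 / 100 * 2 * INR s / n1 * U)
      by (unfold U; field; repeat split; try lra; apply Rgt_not_eq, Pn).
    apply Rmult_le_compat_r; [lra|]. apply Rmult_le_compat_r; [left; apply Rinv_0_lt_compat; lra|].
    lra.
  - replace (cst2 s / (n1 ^ (s - 2) * t ^ s)) with (102 / 100 * (4 * INR s + 1) * U)
      by (unfold U, cst2; field; repeat split; try lra; apply Rgt_not_eq, Pn).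
    assert (Hsn : 0 <= INR s / n1 <= / 2).
    { split; [apply Rmult_le_pos; [lra|left; apply Rinv_0_lt_compat; lra]|].
      apply Rmult_le_reg_r with n1; [lra|]. unfold Rdiv.
      rewrite Rmult_assoc, Rinv_l by lra. lra. }
    assert (Comb : forall W H, 0 <= W -> 1 + (t / (2 * PI - t)) ^ s
       + (t / (2 * PI + t)) ^ (s - 2) * (t / (2 * sin (t / 2))) ^ 2 <= W ->
       0 <= 1 / t -> INR s / n1 * (1 / t + 1 / 2) <= H ->
       4096 / 4095 * W * (V2 / 4 + H) <= 102 / 100 * (4 * INR s + 1) ->
       Rabs (/ gnorm s N * ksum s N 2 t ph')
         + Rabs (/ gnorm s N * ksum s N 1 t ph) * (1 / t + 1 / 2)
       <= 102 / 100 * (4 * INR s + 1) * U).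
    { intros W H HW0 HW Hit HH Hfin.
      pose proof (K1 W HW) as A1. pose proof (K2 W HW) as A2.
      apply Rmult_le_compat_r with (r := 1 / t + 1 / 2) in A1; [|lra].
      assert (A3 : 4096 / 4095 * W * INR s / n1 * U * (1 / t + 1 / 2)
                   <= 4096 / 4095 * W * H * U).
      { replace (4096 / 4095 * W * INR s / n1 * U * (1 / t + 1 / 2))
          with (4096 / 4095 * W * U * (INR s / n1 * (1 / t + 1 / 2))) by (field; lra).
        replace (4096 / 4095 * W * H * U) with (4096 / 4095 * W * U * H) by ring.
        apply Rmult_le_compat_l; [|assumption]. apply Rmult_le_pos; [|lra]. lra. }
      apply Rmult_le_compat_r with (r := U) in Hfin; [|lra]. lra. }
    assert (Hit : 0 < 1 / t) by (apply Rdiv_lt_0_compat; lra).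
    (* Up to pi/2 aliasing is negligible while 1/t may be as large as 2(N+1)/3, giving 2s/3 + 1/4 <=
       0.72 s. Beyond pi/2 the alias factor may double, but 1/t <= 2/3 and s/(N+1) <= 1/2 give (2/3
       + 1/2)/2 = 7/12. *)
    destruct (Rle_dec t (PI / 2)) as [Hle|Hgt].
    + apply (Comb (1004 / 1000) (72 / 100 * INR s)); try lra.
      * pose proof (alias_factor_PI2 t r ltac:(lia) ltac:(lra)) as A.
        replace (2 * (r - 1))%nat with (s - 2)%nat in A by lia. now rewrite <- Hr in A.
      * apply Rle_trans with (INR s / n1 * (2 / 3 * n1 + 1 / 2));
          [apply Rmult_le_compat_l; lra|].
        replace (INR s / n1 * (2 / 3 * n1 + 1 / 2)) with (2 / 3 * INR s + INR s / n1 * (1 / 2))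
          by (field; lra).
        assert (INR s / n1 <= / 2) by lra. lra.
    + assert (1 / t <= 2 / 3).
      { apply Rmult_le_reg_r with t; [assumption|]. replace (1 / t * t) with 1 by (field; lra).
        lra. }
      apply (Comb (2036 / 1000) (7 / 12)); try lra. nra.
Qed.

(** * The kernel as a polynomial in the cosine *)

(** Chebyshev polynomials through their three-term recurrence; the induction carries two consecutive
    orders, each with its first two derivatives. *)
Lemma cos_INR_poly n : exists T T' T'' : R -> R,
  (forall x, derivable_pt_lim T x (T' x)) /\ (forall x, derivable_pt_lim T' x (T'' x)) /\
  forall t, T (cos t) = cos (INR n * t).
Proof.
  enough (H : forall n, (exists T T' T'' : R -> R,
    (forall x, derivable_pt_lim T x (T' x)) /\ (forall x, derivable_pt_lim T' x (T'' x)) /\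
    forall t, T (cos t) = cos (INR n * t)) /\
    (exists T T' T'' : R -> R,
    (forall x, derivable_pt_lim T x (T' x)) /\ (forall x, derivable_pt_lim T' x (T'' x)) /\
    forall t, T (cos t) = cos (INR (S n) * t))) by apply H.
  clear n. induction n as [|n [(A & A' & A'' & HA & HA' & EA) (B & B' & B'' & HB & HB' & EB)]].
  - split.
    + exists (fun _ => 1), (fun _ => 0), (fun _ => 0).
      repeat split; intros; try apply derivable_pt_lim_const. simpl. now rewrite Rmult_0_l, cos_0.
    + exists (fun x => x), (fun _ => 1), (fun _ => 0).
      repeat split; intros; try apply derivable_pt_lim_const; [apply derivable_pt_lim_id|].
      simpl. now rewrite Rmult_1_l.
  - split; [exists B, B', B''; repeat split; assumption|].
    exists (fun x => 2 * (x * B x) - A x), (fun x => 2 * (1 * B x + x * B' x) - A' x),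
      (fun x => 2 * (1 * B' x + (1 * B' x + x * B'' x)) - A'' x).
    repeat split.
    + intros x. apply (derivable_pt_lim_minus (fun x => 2 * (x * B x)) A); [|apply HA].
      apply (derivable_pt_lim_scal (fun x => x * B x)).
      apply (derivable_pt_lim_mult (fun x => x) B); [apply derivable_pt_lim_id|apply HB].
    + intros x. apply (derivable_pt_lim_minus (fun x => 2 * (1 * B x + x * B' x)) A');
        [|apply HA'].
      apply (derivable_pt_lim_scal (fun x => 1 * B x + x * B' x)).
      apply (derivable_pt_lim_plus (fun x => 1 * B x) (fun x => x * B' x)).
      * apply (derivable_pt_lim_scal B), HB.
      * apply (derivable_pt_lim_mult (fun x => x) B'); [apply derivable_pt_lim_id|apply HB'].
    + intros t. rewrite EA, EB, !S_INR. set (m := (INR n + 1) * t).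
      replace (INR n * t) with (m - t) by (unfold m; ring).
      replace ((INR n + 1 + 1) * t) with (m + t) by (unfold m; ring).
      rewrite cos_minus, cos_plus. ring.
Qed.

Lemma cos_sum_poly (a : nat -> R) (z : nat -> Z) n : exists P P' P'' : R -> R,
  (forall x, derivable_pt_lim P x (P' x)) /\ (forall x, derivable_pt_lim P' x (P'' x)) /\
  forall t, P (cos t) = rsum (fun j => a j * cos (IZR (z j) * t)) n.
Proof.
  induction n as [|n (P & P' & P'' & HP & HP' & EP)].
  - exists (fun _ => 0), (fun _ => 0), (fun _ => 0).
    repeat split; intros; try apply derivable_pt_lim_const.
  - destruct (cos_INR_poly (Z.abs_nat (z n))) as (T & T' & T'' & HT & HT' & ET).
    exists (fun x => P x + a n * T x), (fun x => P' x + a n * T' x),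
      (fun x => P'' x + a n * T'' x).
    repeat split.
    + intros x. apply (derivable_pt_lim_plus P (fun x => a n * T x)); [apply HP|].
      apply (derivable_pt_lim_scal T), HT.
    + intros x. apply (derivable_pt_lim_plus P' (fun x => a n * T' x)); [apply HP'|].
      apply (derivable_pt_lim_scal T'), HT'.
    + intros t. cbn [rsum]. rewrite EP, ET. do 2 f_equal.
      rewrite INR_IZR_INZ, Zabs2Nat.id_abs, abs_IZR. unfold Rabs.
      destruct (Rcase_abs (IZR (z n))); [|reflexivity].
      rewrite <- cos_neg. f_equal. ring.
Qed.

(** The two derivative identities come from differentiating P(cos t) by the chain rule and termwise,
    and comparing. They translate the bounds in t into bounds on P' and P'' at cos t. *)
Lemma kernel_poly s N : exists P P' P'' : R -> R,
  (forall x, derivable_pt_lim P x (P' x)) /\ (forall x, derivable_pt_lim P' x (P'' x)) /\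
  forall t, P (cos t) = sigt_re s N t /\
    - (P' (cos t) * sin t) = / gnorm s N * ksum s N 1 t (0 + PI / 2) /\
    P'' (cos t) * sin t ^ 2 - P' (cos t) * cos t
      = / gnorm s N * ksum s N 2 t (0 + PI / 2 + PI / 2).
Proof.
  destruct (cos_sum_poly (fun j => / gnorm s N * coef s N j)
              (fun j => (Z.of_nat j - Z.of_nat N)%Z) (S (2 * N)))
    as (P & P' & P'' & HP & HP' & EP).
  exists P, P', P''. split; [assumption|split; [assumption|]].
  assert (E0 : forall t, P (cos t) = / gnorm s N * ksum s N 0 t 0).
  { intros t. rewrite EP. unfold ksum. rewrite <- rsum_scal. apply rsum_ext; intros j _.
    fold (kval N j). rewrite Rplus_0_r. simpl. ring. }
  assert (Dc : forall (Q Q' : R -> R) t, (forall x, derivable_pt_lim Q x (Q' x)) ->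
            derivable_pt_lim (fun t => Q (cos t)) t (Q' (cos t) * - sin t)).
  { intros Q Q' t HQ. apply (derivable_pt_lim_comp cos Q); [apply derivable_pt_lim_cos|apply HQ]. }
  assert (E1 : forall t, - (P' (cos t) * sin t) = / gnorm s N * ksum s N 1 t (0 + PI / 2)).
  { intros t. transitivity (P' (cos t) * - sin t); [ring|].
    apply (uniqueness_limite (fun t => P (cos t)) t); [now apply Dc|].
    apply (derivable_pt_lim_ext (fun t => / gnorm s N * ksum s N 0 t 0));
      [intros; symmetry; apply E0|].
    apply (derivable_pt_lim_scal (fun t => ksum s N 0 t 0)), derivable_ksum. }
  intros t. split; [now rewrite E0, sigt_re_ksum|split; [apply E1|]].
  apply (uniqueness_limite (fun t => - (P' (cos t) * sin t)) t).
  - replace (P'' (cos t) * sin t ^ 2 - P' (cos t) * cos t)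
      with (- (P'' (cos t) * - sin t * sin t + P' (cos t) * cos t)) by ring.
    apply (derivable_pt_lim_opp (fun t => P' (cos t) * sin t)).
    apply (derivable_pt_lim_mult (fun t => P' (cos t)) sin);
      [now apply Dc|apply derivable_pt_lim_sin].
  - apply (derivable_pt_lim_ext (fun t => / gnorm s N * ksum s N 1 t (0 + PI / 2)));
      [intros; symmetry; apply E1|].
    apply (derivable_pt_lim_scal (fun t => ksum s N 1 t (0 + PI / 2))), derivable_ksum.
Qed.


(** * Rotations *)

Lemma x_cos_le_sin x : 0 <= x <= PI -> x * cos x <= sin x.
Proof.
  intros Hx. destruct (Req_dec x 0) as [->|H0]; [rewrite sin_0; lra|].
  destruct (MVT_cor2 (fun x => sin x - x * cos x) (fun x => x * sin x) 0 x) as [xi [Hxi Hb]].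
  - lra.
  - intros c _. apply is_derive_Reals. auto_derive; [trivial|ring].
  - rewrite sin_0 in Hxi. pose proof (sin_ge_0 xi ltac:(lra) ltac:(lra)).
    assert (0 <= xi * sin xi * (x - 0)) by (repeat apply Rmult_le_pos; lra). lra.
Qed.

(** This is cot(w/2) <= 2/w, freed of denominators so that it includes w = pi; it is x cos x <= sin
    x for x = w/2. *)
Lemma cot_half_bound w : 0 < w <= PI -> w * (1 + cos w) <= 2 * sin w.
Proof.
  intros Hw. set (x := w / 2). replace w with (2 * x) by (unfold x; field).
  rewrite cos_2a_cos, sin_2a. pose proof (x_cos_le_sin x ltac:(unfold x; lra)).
  assert (0 <= cos x) by (apply cos_ge_0; unfold x; lra). nra.
Qed.

(** Indices taken cyclically modulo 3 absorb the signs of the cofactors. *)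
Definition equals_cofactors (z : Mat) : Prop :=
  forall i j, (i < 3)%nat -> (j < 3)%nat ->
    z i j = z ((i + 1) mod 3) ((j + 1) mod 3) * z ((i + 2) mod 3) ((j + 2) mod 3)
          - z ((i + 1) mod 3) ((j + 2) mod 3) * z ((i + 2) mod 3) ((j + 1) mod 3).

Lemma lt3_cases (P : nat -> Prop) : P 0%nat -> P 1%nat -> P 2%nat ->
  forall i, (i < 3)%nat -> P i.
Proof. intros H0 H1 H2 [|[|[|i]]] Hi; try assumption; lia. Qed.

(* For orthogonal z with determinant one, z^T = z^T (z adj z) = adj z. *)
Lemma SO3_cofactors z : inSO3 z -> equals_cofactors z.
Proof.
  intros [Ho Hd] i j Hi Hj.
  assert (E : z i j * det3 z
    = mmul (mtr z) z j 0%nat *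
        (z ((i + 1) mod 3) 1%nat * z ((i + 2) mod 3) 2%nat
         - z ((i + 1) mod 3) 2%nat * z ((i + 2) mod 3) 1%nat)
    + mmul (mtr z) z j 1%nat *
        (z ((i + 1) mod 3) 2%nat * z ((i + 2) mod 3) 0%nat
         - z ((i + 1) mod 3) 0%nat * z ((i + 2) mod 3) 2%nat)
    + mmul (mtr z) z j 2%nat *
        (z ((i + 1) mod 3) 0%nat * z ((i + 2) mod 3) 1%nat
         - z ((i + 1) mod 3) 1%nat * z ((i + 2) mod 3) 0%nat)).
  { revert i Hi. apply lt3_cases; simpl Nat.modulo; unfold det3, mmul, mtr; ring. }
  rewrite Hd, Rmult_1_r in E. rewrite !Ho in E by lia. rewrite E.
  clear E Ho Hd. revert j Hj. apply lt3_cases; unfold kdelta; simpl; ring.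
Qed.

Lemma inSO3_mtr z : inSO3 z -> inSO3 (mtr z).
Proof.
  intros Hz. pose proof (SO3_cofactors z Hz) as C. destruct Hz as [_ Hd]. split.
  - intros i j Hi Hj. unfold mmul, mtr.
    rewrite (C j 0%nat), (C j 1%nat), (C j 2%nat) by lia.
    (* Once one factor is replaced by cofactors, the product of two rows is a Laplace expansion: the
       determinant for equal rows, zero otherwise. *)
    transitivity (kdelta i j * det3 z); [|rewrite Hd; ring].
    clear C. revert i Hi j Hj.
    apply (lt3_cases (fun i => forall j, (j < 3)%nat -> _));
      apply lt3_cases; unfold kdelta, det3; simpl; ring.
  - rewrite <- Hd. unfold det3, mtr. ring.
Qed.

Lemma inSO3_mmul a b : inSO3 a -> inSO3 b -> inSO3 (mmul a b).
Proof.
  intros [Ha Hda] [Hb Hdb]. split.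
  - intros i j Hi Hj. rewrite <- (Hb i j Hi Hj).
    transitivity (
      b 0%nat i * (mmul (mtr a) a 0%nat 0%nat * b 0%nat j + mmul (mtr a) a 0%nat 1%nat * b 1%nat j + mmul (mtr a) a 0%nat 2%nat * b 2%nat j)
      + b 1%nat i * (mmul (mtr a) a 1%nat 0%nat * b 0%nat j + mmul (mtr a) a 1%nat 1%nat * b 1%nat j + mmul (mtr a) a 1%nat 2%nat * b 2%nat j)
      + b 2%nat i * (mmul (mtr a) a 2%nat 0%nat * b 0%nat j + mmul (mtr a) a 2%nat 1%nat * b 1%nat j + mmul (mtr a) a 2%nat 2%nat * b 2%nat j)).
    + unfold mmul, mtr. ring.
    + rewrite !Ha by lia. unfold kdelta, mmul, mtr. simpl. ring.
  - transitivity (det3 a * det3 b); [|rewrite Hda, Hdb; ring]. unfold det3, mmul. ring.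
Qed.

Lemma inSO3_expL n t : inSO3 (expL n t).
Proof.
  pose proof (sin2_cos2 t) as S. unfold Rsqr in S.
  assert (E : sin t * sin t = 1 - cos t * cos t) by lra.
  split.
  - intros i j Hi Hj. revert i Hi j Hj.
    apply (lt3_cases (fun i => forall j, (j < 3)%nat -> _)); apply lt3_cases;
      destruct n as [|[|[|n]]]; unfold kdelta, mmul, mtr; simpl; ring [E].
  - destruct n as [|[|[|n]]]; unfold det3; simpl; ring [E].
Qed.

Definition cosang (z : Mat) : R := (trace z - 1) / 2.

(* sin(omega) times the rotation axis *)
Definition axv (z : Mat) (n : nat) : R :=
  match n with
  | 1%nat => (z 2%nat 1%nat - z 1%nat 2%nat) / 2
  | 2%nat => (z 0%nat 2%nat - z 2%nat 0%nat) / 2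
  | _ => (z 1%nat 0%nat - z 0%nat 1%nat) / 2
  end.

(** The Rodrigues formula gives the symmetric part as cos I + (1 - cos) a a^T with a the axis.
    Multiplication by 1 + cos turns the last term into the product of two components of [axv], which
    makes sense also at angle pi, where the axis is not determined by [axv]. *)
Lemma SO3_sym_part z i j : inSO3 z -> (1 <= i <= 3)%nat -> (1 <= j <= 3)%nat ->
  (1 + cosang z) * ((z (i - 1)%nat (j - 1)%nat + z (j - 1)%nat (i - 1)%nat) / 2
                    - kdelta i j * cosang z)
  = axv z i * axv z j.
Proof.
  intros Hz Hi Hj. pose proof (SO3_cofactors z Hz) as C.
  pose proof (inSO3_mtr z Hz) as [R _]. destruct Hz as [O _].
  assert (H : (i = 1 \/ i = 2 \/ i = 3)%nat) by lia.
  assert (H' : (j = 1 \/ j = 2 \/ j = 3)%nat) by lia.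
  pose proof (C 0 0 ltac:(lia) ltac:(lia))%nat as C00. pose proof (C 0 1 ltac:(lia) ltac:(lia))%nat as C01.
  pose proof (C 0 2 ltac:(lia) ltac:(lia))%nat as C02. pose proof (C 1 0 ltac:(lia) ltac:(lia))%nat as C10.
  pose proof (C 1 1 ltac:(lia) ltac:(lia))%nat as C11. pose proof (C 1 2 ltac:(lia) ltac:(lia))%nat as C12.
  pose proof (C 2 0 ltac:(lia) ltac:(lia))%nat as C20. pose proof (C 2 1 ltac:(lia) ltac:(lia))%nat as C21.
  pose proof (C 2 2 ltac:(lia) ltac:(lia))%nat as C22.
  pose proof (O 0 0 ltac:(lia) ltac:(lia))%nat as O00. pose proof (O 0 1 ltac:(lia) ltac:(lia))%nat as O01.
  pose proof (O 0 2 ltac:(lia) ltac:(lia))%nat as O02. pose proof (O 1 1 ltac:(lia) ltac:(lia))%nat as O11.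
  pose proof (O 1 2 ltac:(lia) ltac:(lia))%nat as O12. pose proof (O 2 2 ltac:(lia) ltac:(lia))%nat as O22.
  pose proof (R 0 0 ltac:(lia) ltac:(lia))%nat as R00. pose proof (R 0 1 ltac:(lia) ltac:(lia))%nat as R01.
  pose proof (R 0 2 ltac:(lia) ltac:(lia))%nat as R02. pose proof (R 1 1 ltac:(lia) ltac:(lia))%nat as R11.
  pose proof (R 1 2 ltac:(lia) ltac:(lia))%nat as R12. pose proof (R 2 2 ltac:(lia) ltac:(lia))%nat as R22.
  clear C O R. unfold mmul, mtr, kdelta in *. simpl in *.
  unfold cosang, trace, axv.
  destruct H as [-> | [-> | ->]], H' as [-> | [-> | ->]]; simpl; lra.
Qed.

Lemma SO3_entry_bound z i j : inSO3 z -> (i < 3)%nat -> (j < 3)%nat -> -1 <= z i j <= 1.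
Proof.
  intros [O _] Hi Hj. pose proof (O j j Hj Hj) as H. unfold mmul, mtr, kdelta in H.
  destruct (Nat.eq_dec j j); [|easy].
  revert i Hi. apply lt3_cases; nra.
Qed.

(** The trace of [SO3_sym_part]. It also yields that the cosine lies in [-1,1], which is what makes
    [acos] invertible here. *)
Lemma axv_sqr_sum z : inSO3 z ->
  axv z 1 * axv z 1 + axv z 2 * axv z 2 + axv z 3 * axv z 3 = 1 - cosang z ^ 2.
Proof.
  intros Hz. rewrite <- !SO3_sym_part by (assumption || lia).
  unfold kdelta, cosang, trace. simpl. field.
Qed.

Lemma cosang_range z : inSO3 z -> -1 <= cosang z <= 1.
Proof. intros Hz. pose proof (axv_sqr_sum z Hz). nra. Qed.

Lemma cos_omega z : inSO3 z -> cos (omega z) = cosang z.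
Proof. intros Hz. apply cos_acos. now apply cosang_range. Qed.

Lemma axv_le_sin z n : inSO3 z -> (1 <= n <= 3)%nat -> Rabs (axv z n) <= sin (omega z).
Proof.
  intros Hz Hn. pose proof (axv_sqr_sum z Hz) as S. pose proof (cos_omega z Hz) as C.
  assert (0 <= sin (omega z)) by (destruct (acos_bound ((trace z - 1) / 2)); now apply sin_ge_0).
  pose proof (sin2_cos2 (omega z)) as Q. unfold Rsqr in Q. rewrite C in Q.
  assert (axv z n * axv z n <= sin (omega z) * sin (omega z)).
  { assert (H' : (n = 1 \/ n = 2 \/ n = 3)%nat) by lia.
    destruct H' as [-> | [-> | ->]]; nra. }
  apply Rabs_le. split; nra.
Qed.

(** The cosine is an explicit trigonometric polynomial in t whose derivative at 0 is the component
    of [axv]. On the right factor the sign is opposite, because y enters through its inverse. *)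
Lemma cosang_left x y n t : (1 <= n <= 3)%nat ->
  let z := mmul (mtr y) x in
  cosang (mmul (mtr (mmul y (expL n t))) x)
  = cosang z + (cos t - 1) * ((trace z - z (n - 1)%nat (n - 1)%nat) / 2) + sin t * axv z n.
Proof.
  intros Hn. assert (H' : (n = 1 \/ n = 2 \/ n = 3)%nat) by lia.
  unfold cosang, trace, mmul, mtr.
  destruct H' as [-> | [-> | ->]]; simpl; field.
Qed.

Lemma cosang_right x y i u : (1 <= i <= 3)%nat ->
  let z := mmul (mtr y) x in
  cosang (mmul (mtr y) (mmul x (expL i u)))
  = cosang z + (cos u - 1) * ((trace z - z (i - 1)%nat (i - 1)%nat) / 2) - sin u * axv z i.
Proof.
  intros Hn. assert (H' : (i = 1 \/ i = 2 \/ i = 3)%nat) by lia.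
  unfold cosang, trace, mmul, mtr.
  destruct H' as [-> | [-> | ->]]; simpl; field.
Qed.

Definition axv_rate (z : Mat) (i n : nat) : R :=
  (kdelta i n * trace z - z (i - 1)%nat (n - 1)%nat) / 2.

Lemma axv_right_assoc x y i n u :
  axv (mmul (mtr y) (mmul x (expL i u))) n = axv (mmul (mmul (mtr y) x) (expL i u)) n.
Proof. destruct n as [|[|[|n]]]; unfold axv, mmul; field. Qed.

Lemma axv_right_0 x y i n : (1 <= i <= 3)%nat ->
  axv (mmul (mtr y) (mmul x (expL i 0))) n = axv (mmul (mtr y) x) n.
Proof.
  intros Hi. rewrite axv_right_assoc. generalize (mmul (mtr y) x); intros z.
  assert (H' : (i = 1 \/ i = 2 \/ i = 3)%nat) by lia.
  destruct H' as [-> | [-> | ->]], n as [|[|[|n]]]; unfold axv, mmul; simpl;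
    rewrite ?cos_0, ?sin_0; field.
Qed.

Lemma derivable_axv_right x y i n : (1 <= i <= 3)%nat -> (1 <= n <= 3)%nat ->
  derivable_pt_lim (fun u => axv (mmul (mtr y) (mmul x (expL i u))) n) 0
    (axv_rate (mmul (mtr y) x) i n).
Proof.
  intros Hi Hn.
  apply (derivable_pt_lim_ext (fun u => axv (mmul (mmul (mtr y) x) (expL i u)) n)).
  { intros u. symmetry. apply axv_right_assoc. }
  generalize (mmul (mtr y) x); intros z. apply is_derive_Reals.
  assert (H' : (i = 1 \/ i = 2 \/ i = 3)%nat) by lia.
  assert (H'' : (n = 1 \/ n = 2 \/ n = 3)%nat) by lia.
  unfold axv_rate, kdelta, trace, axv, mmul.
  destruct H' as [-> | [-> | ->]], H'' as [-> | [-> | ->]]; simpl;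
    (auto_derive; [trivial|rewrite ?cos_0, ?sin_0; field]).
Qed.

(* With [b = sin w * a], the left-hand side equals
   [- a_i a_n (P2 sin^2 w - P1 cos w) + P1/2 ((1 + cos w)(de - a_i a_n) - e)], and
   [(1 + cos w) / sin w = cot (w/2) <= 2 / w]. *)
Lemma hessian_bound P1 P2 w bi bn be de e : 0 < w <= PI ->
  (de = 0 \/ de = 1 /\ bi = bn) -> Rabs bi <= sin w -> Rabs bn <= sin w -> Rabs e <= sin w ->
  2 * (1 + cos w) * be = de * (1 + cos w) ^ 2 - bi * bn - (1 + cos w) * e ->
  (cos w = -1 -> Rabs be <= 1) ->
  Rabs (P2 * - bi * bn + P1 * be)
  <= Rabs (P2 * sin w ^ 2 - P1 * cos w) + Rabs (- (P1 * sin w)) * (1 / w + 1 / 2).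
Proof.
  intros Hw Hde Hbi Hbn He Hbe Hm. rewrite Rabs_Ropp.
  pose proof (sin2_cos2 w) as Q. unfold Rsqr in Q.
  assert (Hs : 0 <= sin w) by (apply sin_ge_0; lra).
  assert (Hiw : 0 < 1 / w) by (apply Rdiv_lt_0_compat; lra).
  (* This is the angle pi: [bi] vanishes, and both sides reduce to multiples of |P1|, with |be| <=
     1. *)
  destruct (Req_dec (sin w) 0) as [S0|S0].
  - assert (bi = 0) as -> by (rewrite S0 in Hbi; revert Hbi; unfold Rabs; destruct (Rcase_abs bi); lra).
    assert (C : cos w = -1).
    { pose proof (cot_half_bound w Hw) as H. rewrite S0 in *.
      pose proof (COS_bound w). nra. }
    specialize (Hm C). rewrite S0, C, !Rmult_0_r, Rabs_R0.
    replace (P2 * - 0 * bn + P1 * be) with (P1 * be) by ring.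
    replace (P2 * 0 ^ 2 - P1 * -1) with P1 by ring. rewrite Rabs_mult.
    pose proof (Rabs_pos P1). nra.
  - assert (Hsp : 0 < sin w) by lra.
    pose proof (COS_bound w) as [HC _]. assert (Hc : 0 < 1 + cos w) by nra.
    set (ai := bi / sin w). set (an := bn / sin w).
    assert (Hdiv : forall b, Rabs b <= sin w -> Rabs (b / sin w) <= 1).
    { intros b Hb. unfold Rdiv. rewrite Rabs_mult, Rabs_inv, (Rabs_right (sin w)) by lra.
      apply Rmult_le_reg_r with (sin w); [assumption|].
      rewrite Rmult_assoc, Rinv_l by lra. lra. }
    pose proof (Hdiv bi Hbi) as Ai. pose proof (Hdiv bn Hbn) as An. fold ai in Ai. fold an in An.
    assert (Ebi : bi = ai * sin w) by (unfold ai; field; lra).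
    assert (Ebn : bn = an * sin w) by (unfold an; field; lra).
    set (p := ai * an).
    assert (Ebe : be = / 2 * (de * (1 + cos w) - p * (1 - cos w) - e)).
    { apply Rmult_eq_reg_l with (2 * (1 + cos w)); [|lra]. rewrite Hbe, Ebi, Ebn.
      replace (ai * sin w * (an * sin w)) with (p * (sin w * sin w)) by (unfold p; ring).
      replace (sin w * sin w) with (1 - cos w * cos w) by lra. field. }
    assert (ED : P2 * - bi * bn + P1 * be
       = - p * (P2 * sin w ^ 2 - P1 * cos w)
         + (P1 * sin w) * (/ 2 * ((1 + cos w) / sin w * (de - p) - e / sin w))).
    { rewrite Ebe, Ebi, Ebn. unfold p. field. lra. }
    rewrite ED. eapply Rle_trans; [apply Rabs_triang|].
    apply Rabs_le_between in Ai. apply Rabs_le_between in An.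
    assert (Hp : -1 <= p <= 1) by (unfold p; split; nra).
    assert (Hdp : Rabs (de - p) <= 1).
    { apply Rabs_le. destruct Hde as [-> | [-> Hb]]; [lra|].
      assert (0 <= p) by (unfold p, ai, an; rewrite Hb; apply Rle_0_sqr). lra. }
    apply Rplus_le_compat.
    + rewrite Rabs_mult. rewrite <- (Rmult_1_l (Rabs (P2 * _ - _))) at 2.
      apply Rmult_le_compat_r; [apply Rabs_pos|]. apply Rabs_le. lra.
    + rewrite Rabs_mult. apply Rmult_le_compat_l; [apply Rabs_pos|].
      assert (Hcot : 0 <= (1 + cos w) / sin w <= 2 / w).
      { split; [apply Rmult_le_pos; [lra|left; now apply Rinv_0_lt_compat]|].
        apply Rmult_le_reg_r with (w * sin w); [nra|].
        replace ((1 + cos w) / sin w * (w * sin w)) with (w * (1 + cos w)) by (field; lra).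
        replace (2 / w * (w * sin w)) with (2 * sin w) by (field; lra).
        now apply cot_half_bound. }
      pose proof (Hdiv e He) as Ae. apply Rabs_le_between in Ae.
      apply Rabs_le_between in Hdp. set (q := (1 + cos w) / sin w) in *.
      assert (- q <= q * (de - p) <= q) by nra.
      replace (2 / w) with (2 * (1 / w)) in Hcot by (field; lra).
      apply Rabs_le. lra.
Qed.

Lemma axv_rate_bound P1 P2 z i n : inSO3 z -> (1 <= i <= 3)%nat -> (1 <= n <= 3)%nat ->
  0 < omega z ->
  let w := omega z in
  Rabs (P2 * - axv z i * axv z n + P1 * axv_rate z i n)
  <= Rabs (P2 * sin w ^ 2 - P1 * cos w) + Rabs (- (P1 * sin w)) * (1 / w + 1 / 2).
Proof.
  intros Hz Hi Hn Hw w.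
  pose proof (acos_bound ((trace z - 1) / 2)) as Hb. fold (omega z) in Hb. fold w in Hb, Hw.
  pose proof (cos_omega z Hz) as Hc. fold w in Hc.
  pose proof (SO3_sym_part z i n Hz Hi Hn) as S.
  pose proof (SO3_entry_bound z (i - 1) (n - 1) Hz ltac:(lia) ltac:(lia)) as B.
  assert (Et : trace z = 1 + 2 * cosang z) by (unfold cosang; field).
  apply hessian_bound with (de := kdelta i n)
    (e := (z (i - 1)%nat (n - 1)%nat - z (n - 1)%nat (i - 1)%nat) / 2).
  - lra.
  - unfold kdelta. destruct (Nat.eq_dec i n) as [->|]; [right|left]; auto.
  - now apply axv_le_sin.
  - now apply axv_le_sin.
  - pose proof (axv_le_sin z 1 Hz ltac:(lia)) as A1. pose proof (axv_le_sin z 2 Hz ltac:(lia)) as A2.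
    pose proof (axv_le_sin z 3 Hz ltac:(lia)) as A3. fold w in A1, A2, A3.
    apply Rabs_le_between in A1. apply Rabs_le_between in A2. apply Rabs_le_between in A3.
    apply Rabs_le. unfold axv in A1, A2, A3.
    (* The halved antisymmetric entries are zero or, up to sign, components of [axv], hence at most
       sin w. *)
    assert (H' : (i = 1 \/ i = 2 \/ i = 3)%nat) by lia.
    assert (H'' : (n = 1 \/ n = 2 \/ n = 3)%nat) by lia.
    destruct H' as [-> | [-> | ->]], H'' as [-> | [-> | ->]]; simpl; lra.
  - rewrite Hc, <- S. unfold axv_rate, kdelta. rewrite Et.
    destruct (Nat.eq_dec i n) as [->|]; field.
  (* At angle pi the trace is -1, so the rate is minus half the sum of a Kronecker delta and a
     matrix entry. *)
  - rewrite Hc. intros Hm. unfold axv_rate, kdelta. rewrite Et, Hm. apply Rabs_le.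
    destruct (Nat.eq_dec i n); lra.
Qed.

Lemma sigma_re_poly s N (P : R -> R) x y : inSO3 (mmul (mtr y) x) ->
  (forall t, P (cos t) = sigt_re s N t) -> sigma_re s N x y = P (cosang (mmul (mtr y) x)).
Proof. intros Hz HP. unfold sigma_re. now rewrite <- HP, cos_omega. Qed.

Lemma derivable_sigma_re s N (P P' : R -> R) x y n : inSO3 x -> inSO3 y -> (1 <= n <= 3)%nat ->
  (forall c, derivable_pt_lim P c (P' c)) -> (forall t, P (cos t) = sigt_re s N t) ->
  derivable_pt_lim (fun t => sigma_re s N x (mmul y (expL n t))) 0
    (P' (cosang (mmul (mtr y) x)) * axv (mmul (mtr y) x) n).
Proof.
  intros Hx Hy Hn HP EP.
  set (z := mmul (mtr y) x).
  set (C := fun t => cosang z + (cos t - 1) * ((trace z - z (n - 1)%nat (n - 1)%nat) / 2)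
                     + sin t * axv z n).
  apply (derivable_pt_lim_ext (fun t => P (C t))).
  { intros t. rewrite (sigma_re_poly s N P); [|apply inSO3_mmul; [|assumption]|assumption].
    - unfold C, z. now rewrite <- cosang_left.
    - apply inSO3_mtr, inSO3_mmul; [assumption|apply inSO3_expL]. }
  assert (C0 : C 0 = cosang z) by (unfold C; rewrite cos_0, sin_0; ring).
  rewrite <- C0. apply (derivable_pt_lim_comp C P); [|apply HP].
  apply is_derive_Reals. unfold C. auto_derive; [trivial|]. rewrite cos_0, sin_0. ring.
Qed.

Lemma cmod_0_r a : cmod a 0 = Rabs a.
Proof.
  unfold cmod. rewrite <- sqrt_Rsqr_abs. f_equal. unfold Rsqr. ring.
Qed.

(* X_n^y sigma_N(x,y) = d/dt sigma_N(x, y e^{t L_n}) |_{t=0};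
   X_i^x X_n^y sigma_N(x,y) = d/du [ (X_n^y sigma_N)(x e^{u L_i}, y) ] |_{u=0}.
   sigma_N is complex valued: (re, im) parts. *)
Theorem theorem3p1 (s N : nat) (x y : Mat)
  (hs6 : (6 <= s)%nat) (hseven : Nat.Even s) (hN : (2 * s <= N)%nat)
  (hx : inSO3 x) (hy : inSO3 y)
  (hw : PI / (2 * INR (N + 1)) <= omega (mmul (mtr y) x)) :
  forall i n : nat, (1 <= i <= 3)%nat -> (1 <= n <= 3)%nat ->
  (exists dre dim : R,
     derivable_pt_lim (fun t => sigma_re s N x (mmul y (expL n t))) 0 dre /\
     derivable_pt_lim (fun t => sigma_im s N x (mmul y (expL n t))) 0 dim /\
     cmod dre dim <= cst1 s / (INR (N + 1) ^ (s - 1) * omega (mmul (mtr y) x) ^ s))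
  /\
  (exists (gre gim : R -> R) (delta : R), 0 < delta /\
     (forall u, Rabs u < delta ->
        derivable_pt_lim (fun t => sigma_re s N (mmul x (expL i u)) (mmul y (expL n t))) 0 (gre u) /\
        derivable_pt_lim (fun t => sigma_im s N (mmul x (expL i u)) (mmul y (expL n t))) 0 (gim u)) /\
     exists dre dim : R,
       derivable_pt_lim gre 0 dre /\ derivable_pt_lim gim 0 dim /\
       cmod dre dim <= cst2 s / (INR (N + 1) ^ (s - 2) * omega (mmul (mtr y) x) ^ s)).
Proof.
  intros i n Hi Hn.
  destruct (kernel_poly s N) as (P & P' & P'' & HP & HP' & HK).
  assert (EP : forall t, P (cos t) = sigt_re s N t) by (intros t; apply HK).
  assert (Him : forall a b, derivable_pt_lim (fun t => sigma_im s N a (mmul b (expL n t))) 0 0).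
  { intros a b. apply (derivable_pt_lim_ext (fun _ => 0)).
    - intros t. symmetry. apply sigt_im_0; [lia|assumption].
    - apply derivable_pt_lim_const. }
  set (z := mmul (mtr y) x) in *.
  assert (Hz : inSO3 z) by (apply inSO3_mmul; [now apply inSO3_mtr|assumption]).
  pose proof (acos_bound ((trace z - 1) / 2)) as Hb. fold (omega z) in Hb.
  set (w := omega z) in *.
  assert (Hw0 : 0 < w).
  { eapply Rlt_le_trans; [|exact hw]. pose proof PI_RGT_0.
    apply Rdiv_lt_0_compat; [assumption|].
    apply Rmult_lt_0_compat; [lra|apply lt_0_INR; lia]. }
  pose proof (cos_omega z Hz) as Hc. fold w in Hc.
  destruct (HK w) as (_ & K1 & K2).
  destruct (kernel_bounds s N w (0 + PI / 2) (0 + PI / 2 + PI / 2) hs6 hseven hN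
              (conj hw (proj2 Hb))) as [B1 B2].
  rewrite <- K1 in B1, B2. rewrite <- K2 in B2.
  split.
  - exists (P' (cosang z) * axv z n), 0. split; [|split; [apply Him|]].
    + now apply (derivable_sigma_re s N P P').
    + rewrite cmod_0_r. eapply Rle_trans; [|exact B1].
      rewrite Rabs_Ropp, !Rabs_mult, Hc. apply Rmult_le_compat_l; [apply Rabs_pos|].
      eapply Rle_trans; [now apply axv_le_sin|apply Rle_abs].
  - set (zu := fun u => mmul (mtr y) (mmul x (expL i u))).
    (* The formula for the inner derivative holds for every u, so any positive radius serves. *)
    exists (fun u => P' (cosang (zu u)) * axv (zu u) n), (fun _ => 0), 1.
    split; [lra|split].
    + intros u _. split; [|apply Him].
      apply (derivable_sigma_re s N P P'); try assumption.
      apply inSO3_mmul; [assumption|apply inSO3_expL].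
    (* The product rule: along the rotation of x the cosine has derivative -axv_i and [axv] has
       derivative [axv_rate]. *)
    + exists (P'' (cosang z) * - axv z i * axv z n + P' (cosang z) * axv_rate z i n), 0.
      split; [|split; [apply derivable_pt_lim_const|]].
      * set (C := fun u => cosang z + (cos u - 1) * ((trace z - z (i - 1)%nat (i - 1)%nat) / 2)
                     - sin u * axv z i).
        assert (C0 : C 0 = cosang z) by (unfold C; rewrite cos_0, sin_0; ring).
        apply (derivable_pt_lim_ext (fun u => P' (C u) * axv (zu u) n)).
        { intros u. unfold C, zu, z. now rewrite <- cosang_right. }
        rewrite <- C0, <- (axv_right_0 x y i n Hi : axv (zu 0) n = axv z n).
        apply (derivable_pt_lim_mult (fun u => P' (C u)) (fun u => axv (zu u) n)).
        -- apply (derivable_pt_lim_comp C P'); [|apply HP'].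
           apply is_derive_Reals. unfold C. auto_derive; [trivial|]. rewrite cos_0, sin_0. ring.
        -- now apply derivable_axv_right.
      * rewrite cmod_0_r. eapply Rle_trans; [|exact B2]. rewrite <- Hc.
        now apply axv_rate_bound.
Qed.
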